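(* Let $A$ be a skew-selfadjoint operator with a simple spectrum acting on a Hilbert quaternion bimodule $H$. Then there exists a finite positive Borel measure $\sigma$ on $\mathbf{f}_+$ such that $A$ is unitarily equivalent to the operator $Q$ of left multiplication by the independent variable on $L^2_\sigma(\mathbf{f}_+,\mathbb{H})$, $$(Qh)(\lambda)=\lambda h(\lambda),\qquad \mathcal{D}(Q)=\Big\{h\in L^2_\sigma(\mathbf{f}_+,\mathbb{H})\;\Big|\;\int_{\mathbf{f}_+}|\lambda|^2|h(\lambda)|^2\sigma(d\lambda)<\infty\Big\}.$$
   Context: $\mathbb{H}$ denotes the real quaternions. $f\in\mathbb{H}$ is a fixed imaginary unit (a quaternion with zero real part and absolute value $1$), and $\mathbf{f}_+=\{\tau f\mid \tau\ge 0\}$, with Borel $\sigma$-algebra $\mathfrak{B}(\mathbf{f}_+)$. $H$ is a Hilbert quaternion bimodule, i.e. an $\mathbb{H}$-bimodule complete with respect to the norm of an $\mathbb{H}$-valued inner product with $\langle xq,y\rangle=\langle x,y\rangle q$ and $\langle x,yq\rangle=\overline{q}\,\langle x,y\rangle$ for $q\in\mathbb{H}$. ''Linear operator'' means right $\mathbb{H}$-linear operator (only the right module structure matters). For $q\in\mathbb{H}$, $R_q x:=xq$ for $x\in H$. A skew-selfadjoint operator is a densely defined linear operator $A$ with $A^*=-A$. Spectral measure $E$ of $A$ (known spectral theorem, used as background): for every skew-selfadjoint operator $A$ on $H$ there exist a spectral measure $E$ on $\mathfrak{B}(\mathbf{f}_+)$ (with values in the $\mathbb{H}$-linear orthogonal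 projections of $H$) and a bounded skew-selfadjoint operator $J$ on $H$, commuting with $E$, with $J^2=-I$, such that $$\mathcal{D}(A)=\Big\{h\in H \;\Big|\; \int_{\mathbf{f}_+}|q|^2\langle E(dq)h,h\rangle<\infty\Big\},\qquad A=\int_{\mathbf{f}_+}R_{-qf}\,J\,E(dq),$$ the last integral being understood as $Ah=\lim_{n\to\infty}\int_{[0,nf]}R_{-qf}JE(dq)h$ for $h\in\mathcal{D}(A)$. (For $q=\tau f$ one has $-qf=\tau$.) Such a pair $E,J$ is fixed for $A$. Let $\mathcal{I}$ be the set of all bounded intervals $\Delta=[af,bf]=\{\tau f\mid a\le\tau\le b\}$ with $a,b\in\mathbb{R}$, $0\le a<b$. A vector $g\in H$ is a generating vector for $A$ if the norm closure of the right $\mathbb{H}$-linear span of $\{E(\Delta)g\mid \Delta\in\mathcal{I}\}$ equals $H$. $A$ is an operator with a simple spectrum if it has a generating vector. $L^2_\sigma(\mathbf{f}_+,\mathbb{H})$ is the $\mathbb{H}$-bimodule of ($\sigma$-classes of) $\mathbb{H}$-valued functions on $\mathbf{f}_+$ square integrable with respect to $\sigma$, with inner product $\langle h,k\rangle=\int_{\mathbf{f}_+}\overline{k(\lambda)}h(\lambda)\,\sigma(d\lambda)$. Unitary equivalence of $A$ and $Q$ means that there is a surjective isometric (right $\mathbb{H}$-linear) operator $\Phi:L^2_\sigma(\mathbf{f}_+,\mathbb{H})\to H$ with $A=\Phi Q\Phi^{-1}$, including equality of domains. *)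

(* Defs.v *)
From HB Require Import structures.
From mathcomp Require Import all_boot all_order all_algebra.
From mathcomp Require Import all_classical all_reals all_analysis.
From mathcomp Require Import measurable_realfun generic_quotient ring_quotient.
From mathcomp Require Import ring lra.

Set Implicit Arguments.
Unset Strict Implicit.
Unset Printing Implicit Defensive.

Import Order.TTheory GRing.Theory Num.Theory.
Import numFieldNormedType.Exports.

Local Open Scope classical_set_scope.
Local Open Scope ring_scope.

(* [Quat a b c d] is a + b i + c j + d k. *)
Record quat (R : Type) : Type := Quat { qre : R; qi : R; qj : R; qk : R }.

Section QuatAlgebra.
Context {R : realType}.
Implicit Types p q r : quat R.

HB.instance Definition _ := gen_eqMixin (quat R).
HB.instance Definition _ := gen_choiceMixin (quat R).

Lemma quatP p q :
  qre p = qre q -> qi p = qi q -> qj p = qj q -> qk p = qk q -> p = q.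
Proof. by case: p => a b c d; case: q => ? ? ? ? /= -> -> -> ->. Qed.

Definition quat_add p q :=
  Quat (qre p + qre q) (qi p + qi q) (qj p + qj q) (qk p + qk q).
Definition quat_opp q := Quat (- qre q) (- qi q) (- qj q) (- qk q).
Definition quat_mul p q := Quat
  (qre p * qre q - qi p * qi q - qj p * qj q - qk p * qk q)
  (qre p * qi q + qi p * qre q + qj p * qk q - qk p * qj q)
  (qre p * qj q - qi p * qk q + qj p * qre q + qk p * qi q)
  (qre p * qk q + qi p * qj q - qj p * qi q + qk p * qre q).
Definition quat_scale (a : R) q := Quat (a * qre q) (a * qi q) (a * qj q) (a * qk q).

Fact quat_addA : associative quat_add.
Proof. by move=> *; apply: quatP => /=; ring. Qed.
Fact quat_addC : commutative quat_add.
Proof. by move=> *; apply: quatP => /=; ring. Qed.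
Fact quat_add0l : left_id (Quat 0 0 0 0) quat_add.
Proof. by move=> *; apply: quatP => /=; ring. Qed.
Fact quat_addNl : left_inverse (Quat 0 0 0 0) quat_opp quat_add.
Proof. by move=> *; apply: quatP => /=; ring. Qed.
HB.instance Definition _ :=
  GRing.isZmodule.Build (quat R) quat_addA quat_addC quat_add0l quat_addNl.

Fact quat_mulA : associative quat_mul.
Proof. by move=> *; apply: quatP => /=; ring. Qed.
Fact quat_mul1l : left_id (Quat 1 0 0 0) quat_mul.
Proof. by move=> *; apply: quatP => /=; ring. Qed.
Fact quat_mul1 : right_id (Quat 1 0 0 0) quat_mul.
Proof. by move=> *; apply: quatP => /=; ring. Qed.
Fact quat_mulDl : left_distributive quat_mul +%R.
Proof. by move=> *; apply: quatP => /=; ring. Qed.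
Fact quat_mulDr : right_distributive quat_mul +%R.
Proof. by move=> *; apply: quatP => /=; ring. Qed.
Fact quat_one_neq0 : Quat 1 0 0 0 != 0 :> quat R.
Proof. by apply/eqP => -[/eqP]; rewrite oner_eq0. Qed.
HB.instance Definition _ := GRing.Zmodule_isNzRing.Build (quat R)
  quat_mulA quat_mul1l quat_mul1 quat_mulDl quat_mulDr quat_one_neq0.

Fact quat_scaleA a b q : quat_scale a (quat_scale b q) = quat_scale (a * b) q.
Proof. by apply: quatP => /=; ring. Qed.
Fact quat_scale1l : left_id 1 quat_scale.
Proof. by move=> *; apply: quatP => /=; ring. Qed.
Fact quat_scaleDr : right_distributive quat_scale +%R.
Proof. by move=> *; apply: quatP => /=; ring. Qed.
Fact quat_scaleDl q : {morph quat_scale^~ q : a b / a + b}.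
Proof. by move=> *; apply: quatP => /=; ring. Qed.
HB.instance Definition _ := GRing.Zmodule_isLmodule.Build R (quat R)
  quat_scaleA quat_scale1l quat_scaleDr quat_scaleDl.

Fact quat_scaleAl (a : R) p q : a *: (p * q) = (a *: p) * q.
Proof. by apply: quatP => /=; ring. Qed.
HB.instance Definition _ := GRing.Lmodule_isLalgebra.Build R (quat R) quat_scaleAl.
Fact quat_scaleAr (a : R) p q : a *: (p * q) = p * (a *: q).
Proof. by apply: quatP => /=; ring. Qed.
HB.instance Definition _ := GRing.Lalgebra_isAlgebra.Build R (quat R) quat_scaleAr.

Definition quat_conj q := Quat (qre q) (- qi q) (- qj q) (- qk q).

Definition quat_sqnorm q : R := qre q ^+ 2 + qi q ^+ 2 + qj q ^+ 2 + qk q ^+ 2.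

Definition quat_norm q : R := Num.sqrt (quat_sqnorm q).

Lemma quat_sqnorm_ge0 q : 0 <= quat_sqnorm q.
Proof. by rewrite !addr_ge0 ?sqr_ge0. Qed.

Fact quat_ler_normD p q : quat_norm (p + q) <= quat_norm p + quat_norm q.
Proof.
have pq0 : 0 <= quat_norm p + quat_norm q by rewrite addr_ge0 ?sqrtr_ge0.
rewrite -[leRHS]ger0_norm// -sqrtr_sqr ler_sqrt ?sqr_ge0//.
rewrite sqrrD !sqr_sqrtr ?quat_sqnorm_ge0//.
set s := qre p * qre q + qi p * qi q + qj p * qj q + qk p * qk q.
have -> : quat_sqnorm (p + q) = quat_sqnorm p + s *+ 2 + quat_sqnorm q.
  by rewrite /quat_sqnorm /s /=; ring.
rewrite lerD2r lerD2l lerMn2r /= -sqrtrM ?quat_sqnorm_ge0//.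
rewrite (le_trans (ler_norm s))// -sqrtr_sqr ler_sqrt ?mulr_ge0 ?quat_sqnorm_ge0//.
rewrite -subr_ge0 /quat_sqnorm /s.
set a := qre p; set b := qi p; set c := qj p; set d := qk p.
set a' := qre q; set b' := qi q; set c' := qj q; set d' := qk q.
have -> : (a ^+ 2 + b ^+ 2 + c ^+ 2 + d ^+ 2)
  * (a' ^+ 2 + b' ^+ 2 + c' ^+ 2 + d' ^+ 2)
  - (a * a' + b * b' + c * c' + d * d') ^+ 2
  = (a * b' - b * a') ^+ 2 + (a * c' - c * a') ^+ 2 + (a * d' - d * a') ^+ 2
    + (b * c' - c * b') ^+ 2 + (b * d' - d * b') ^+ 2
    + (c * d' - d * c') ^+ 2 by ring.
by rewrite !addr_ge0 ?sqr_ge0.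
Qed.

Fact quat_normZ (a : R) q : quat_norm (a *: q) = `|a| * quat_norm q.
Proof.
have -> : quat_norm (a *: q) = Num.sqrt (a ^+ 2 * quat_sqnorm q).
  by congr Num.sqrt; rewrite /quat_sqnorm /=; ring.
by rewrite sqrtrM ?sqr_ge0// sqrtr_sqr.
Qed.

Fact quat_norm_eq0 q : quat_norm q = 0 -> q = 0.
Proof.
move=> /eqP; rewrite sqrtr_eq0 => q0.
have {}q0 : quat_sqnorm q = 0 by apply/eqP; rewrite eq_le q0 quat_sqnorm_ge0.
have := sqr_ge0 (qre q); have := sqr_ge0 (qi q).
have := sqr_ge0 (qj q); have := sqr_ge0 (qk q).
rewrite /quat_sqnorm in q0 => *.
by apply: quatP; apply/eqP; rewrite -sqrf_eq0; apply/eqP => /=; lra.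
Qed.

Fact quat_normMn q n : quat_norm (q *+ n) = quat_norm q *+ n.
Proof.
by rewrite -[q *+ n]scaler_nat quat_normZ ger0_norm ?ler0n// mulr_natl.
Qed.
Fact quat_normN q : quat_norm (- q) = quat_norm q.
Proof. by rewrite -scaleN1r quat_normZ normrN1 mul1r. Qed.
HB.instance Definition _ := Num.Zmodule_isNormed.Build R (quat R)
  quat_ler_normD quat_norm_eq0 quat_normMn quat_normN.
HB.instance Definition _ :=
  PseudoMetric.copy (quat R) (pseudoMetric_normed (quat R)).
HB.instance Definition _ := isPointed.Build (quat R) 0.
HB.instance Definition _ :=
  NormedZmod_PseudoMetric_eq.Build R (quat R) erefl.
HB.instance Definition _ :=
  PseudoMetricNormedZmod_Lmodule_isNormedModule.Build R (quat R) quat_normZ.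

Lemma quat_normE q : `|q| = Num.sqrt (quat_sqnorm q). Proof. by []. Qed.

Lemma sqr_quat_norm q : `|q| ^+ 2 = quat_sqnorm q.
Proof. by rewrite quat_normE sqr_sqrtr ?quat_sqnorm_ge0. Qed.

Lemma quat_normM p q : `|p * q| = `|p| * `|q|.
Proof.
rewrite !quat_normE -sqrtrM ?quat_sqnorm_ge0//; congr Num.sqrt.
by rewrite /quat_sqnorm /=; ring.
Qed.

End QuatAlgebra.

(* Borel sigma-algebra of the Euclidean topology on the quaternions. *)
HB.instance Definition _ (R : realType) :=
  Measurable.copy (quat R) (g_sigma_algebraType (@open (quat R))).

Section QuatMeasurable.
Context {R : realType} d (T : measurableType d).

Lemma ler_norm_components (q : quat R) :
  [/\ `|qre q| <= `|q|, `|qi q| <= `|q|, `|qj q| <= `|q| & `|qk q| <= `|q|].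
Proof.
have le x : x ^+ 2 <= quat_sqnorm q -> `|x| <= `|q|.
  by move=> h; rewrite quat_normE -sqrtr_sqr ler_sqrt ?quat_sqnorm_ge0.
have := sqr_ge0 (qre q); have := sqr_ge0 (qi q).
have := sqr_ge0 (qj q); have := sqr_ge0 (qk q).
by rewrite /quat_sqnorm in le => *; split; apply: le; lra.
Qed.

Lemma measurable_contraction (c : quat R -> R) (h : T -> quat R) :
  (forall p q, `|c p - c q| <= `|p - q|) ->
  measurable_fun setT h -> measurable_fun setT (c \o h).
Proof.
move=> c1 mh.
apply: (measurability _ (RGenOpens.measurableE R)).
move=> _ [_ [a [b ->]] <-]; rewrite setTI comp_preimage -[X in measurable X]setTI.
apply: mh => //; apply: sub_sigma_algebra.
have cc : continuous (c : quat R -> R).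
  move=> p; apply/(@cvgrPdist_lt _ _ _ (nbhs p)) => e e0.
  apply: filterS (nbhsx_ballx p e e0) => q; rewrite -ball_normE /=.
  exact: le_lt_trans.
by move/continuousP : cc; apply; exact: interval_open.
Qed.

Lemma measurable_components (h : T -> quat R) : measurable_fun setT h ->
  [/\ measurable_fun setT (@qre R \o h), measurable_fun setT (@qi R \o h),
      measurable_fun setT (@qj R \o h) & measurable_fun setT (@qk R \o h)].
Proof.
by move=> mh; split; apply: measurable_contraction mh => p q;
  have [] := ler_norm_components (p - q).
Qed.

Lemma open_quat_rat (U : set (quat R)) : open U ->
  U = \bigcup_(x in [set x : (rat * rat * rat * rat * nat)%type |
        ball (Quat (ratr x.1.1.1.1) (ratr x.1.1.1.2) (ratr x.1.1.2) (ratr x.1.2))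
          x.2.+1%:R^-1 `<=` U])
      ball (Quat (ratr x.1.1.1.1) (ratr x.1.1.1.2) (ratr x.1.1.2) (ratr x.1.2) : quat R)
          x.2.+1%:R^-1.
Proof.
move=> oU; apply/seteqP; split=> [p Up|p [x /= xU /xU//]].
have := oU; rewrite openE => /(_ _ Up) /nbhs_ballP[e /= e0 peU].
have [n ne] : exists n : nat, n.+1%:R^-1 < e / 2.
  exists (Num.truncn (e / 2)^-1); rewrite invf_plt ?posrE ?divr_gt0//.
  exact: truncnS_gt.
have r0 : (0 : R) < n.+1%:R^-1 / 2 by rewrite divr_gt0.
have near_rat (x : R) : exists q : rat, `|x - ratr q| < n.+1%:R^-1 / 2.
  have /rat_in_itvoo[q] : x - n.+1%:R^-1 / 2 < x + n.+1%:R^-1 / 2.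
    by rewrite ltrBlDr -addrA ltrDl addr_gt0.
  rewrite in_itv /= => /andP[xq qx]; exists q.
  by rewrite distrC ltr_distl xq qx.
have [a ha] := near_rat (qre p); have [b hb] := near_rat (qi p).
have [c hc] := near_rat (qj p); have [f hf] := near_rat (qk p).
have sq (x : R) : `|x| < n.+1%:R^-1 / 2 -> x ^+ 2 < (n.+1%:R^-1 / 2) ^+ 2.
  by move=> xn; rewrite -(real_normK (num_real x)) ltrXn2r ?nnegrE ?(ltW r0).
have pr : `|p - Quat (ratr a) (ratr b) (ratr c) (ratr f)| < n.+1%:R^-1.
  have n0 : (0 : R) <= n.+1%:R^-1 by rewrite invr_ge0.
  rewrite -(ltr_pXn2r (_ : 0 < 2)%N) ?nnegrE// sqr_quat_norm /quat_sqnorm /=.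
  by move: (sq _ ha) (sq _ hb) (sq _ hc) (sq _ hf); rewrite !expr_div_n;
    move: (n.+1%:R^-1 ^+ 2) => E; lra.
exists (a, b, c, f, n) => /=; last by rewrite -ball_normE /= distrC.
move=> q; rewrite -ball_normE /= => hq; apply: peU; rewrite -ball_normE /=.
rewrite (le_lt_trans (ler_distD (Quat (ratr a) (ratr b) (ratr c) (ratr f)) _ _))//.
by rewrite (splitr e) ltrD// ?(lt_trans pr)// (lt_trans hq).
Qed.

Lemma measurable_quat (h : T -> quat R) :
  measurable_fun setT (@qre R \o h) -> measurable_fun setT (@qi R \o h) ->
  measurable_fun setT (@qj R \o h) -> measurable_fun setT (@qk R \o h) ->
  measurable_fun setT h.
Proof.
move=> m0 m1 m2 m3; apply: (@measurability _ _ _ _ _ _ (@open (quat R))) => //.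
move=> _ [U oU <-]; rewrite (open_quat_rat oU) preimage_bigcup setTI.
rewrite bigcup_mkcond; apply: countable_bigcupT_measurable => // -[[[[a b] c] f] n].
case: ifPn => // _; rewrite -ball_normE.
set p : quat R := Quat _ _ _ _; set e : R := _^-1.
have e0 : 0 <= e by rewrite invr_ge0.
rewrite [X in measurable X](_ : _ =
  [set x | quat_sqnorm (p - h x) < e ^+ 2]); last first.
  apply/seteqP; split=> x /=; rewrite -sqr_quat_norm;
  by rewrite ltr_pXn2r ?nnegrE.
rewrite -[X in measurable X]setTI.
apply: (@measurable_fun_ltr _ _ _ setT (fun x => quat_sqnorm (p - h x)) (cst (e ^+ 2)) _ _ measurableT [set true]) => //.
by rewrite /quat_sqnorm /=; repeat apply: measurable_funD; apply: measurable_funX;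
  apply: measurable_funB.
Qed.

Lemma measurable_sqr_norm (h : T -> quat R) :
  measurable_fun setT h -> measurable_fun setT (fun x => (`|h x| ^+ 2)%:E).
Proof.
move=> /measurable_components[m0 m1 m2 m3]; apply/measurable_EFinP.
rewrite [X in measurable_fun _ X](_ : _ = fun x => quat_sqnorm (h x)); last first.
  by apply/funext => x; rewrite sqr_quat_norm.
by rewrite /quat_sqnorm; repeat apply: measurable_funD; apply: measurable_funX.
Qed.

End QuatMeasurable.

Section L2.
Context {R : realType} {d} {T : measurableType d}.
Variable mu : {measure set T -> \bar R}.

Definition l2_fun : {pred T -> quat R} := mem [set h : T -> quat R |
  measurable_fun setT h /\ (\int[mu]_x (`|h x| ^+ 2)%:E < +oo)%E].

Fact l2_zmod_closed : zmod_closed l2_fun.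
Proof.
split=> [|f g]; rewrite !inE /=.
  split; first exact: measurable_cst.
  by rewrite integral0_eq// => x _; rewrite [X in `|X|](_ : _ = 0)// normr0 expr0n.
move=> [mf f2] [mg g2].
have mfg : measurable_fun setT (f - g).
  have [f0 f1 f3 f4] := measurable_components mf.
  have [g0 g1 g3 g4] := measurable_components mg.
  by apply: measurable_quat; apply: measurable_funB.
split=> //; have pos (h : T -> quat R) x :
    (0 <= 2%:E * (`|h x| ^+ 2)%:E :> \bar R)%E.
  by rewrite -EFinM lee_fin mulr_ge0 ?sqr_ge0.
have m2 (h : T -> quat R) : measurable_fun setT h ->
    measurable_fun setT (fun x => (2%:E * (`|h x| ^+ 2)%:E)%E).
  by move=> mh; apply: measurable_funeM; exact: measurable_sqr_norm.
apply: (@le_lt_trans _ _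
  (\int[mu]_x (2%:E * (`|f x| ^+ 2)%:E + 2%:E * (`|g x| ^+ 2)%:E))%E).
  have p1 x : (0 <= (`|(f - g) x| ^+ 2)%:E :> \bar R)%E by rewrite lee_fin sqr_ge0.
  have mm := measurable_sqr_norm mfg.
  have mD := emeasurable_funD (m2 _ mf) (m2 _ mg).
  apply: ge0_le_integral; [by []|by []|exact: mm|exact: mD|].
  move=> x _; rewrite -!EFinM -EFinD lee_fin.
  have fg : `|(f - g) x| <= `|f x| + `|g x| by exact: ler_normB.
  rewrite (@le_trans _ _ ((`|f x| + `|g x|) ^+ 2))//.
    by rewrite lerXn2r ?nnegrE ?addr_ge0.
  by have := sqr_ge0 (`|f x| - `|g x|); rewrite sqrrB sqrrD; lra.
have Zl (h : T -> quat R) : measurable_fun setT h ->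
    (\int[mu]_x (2%:E * (`|h x| ^+ 2)%:E) = 2%:E * \int[mu]_x (`|h x| ^+ 2)%:E)%E.
  move=> mh; apply: ge0_integralZl_EFin => //; exact: measurable_sqr_norm.
rewrite (ge0_integralD _ measurableT (fun x _ => pos f x) (m2 _ mf)
  (fun x _ => pos g x) (m2 _ mg)) !Zl//.
by apply: lte_add_pinfty; apply: lte_mul_pinfty; rewrite ?lee_fin.
Qed.
HB.instance Definition _ :=
  GRing.isZmodClosed.Build (T -> quat R) l2_fun l2_zmod_closed.

Record L2fun := MkL2fun {
  L2fun_val :> T -> quat R;
  L2fun_valP : L2fun_val \in l2_fun }.
HB.instance Definition _ := [isSub for L2fun_val].
HB.instance Definition _ := [Choice of L2fun by <:].
HB.instance Definition _ := [SubChoice_isSubZmodule of L2fun by <:].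

Definition l2_null : {pred L2fun} :=
  mem [set h : L2fun | {ae mu, forall x, h x = 0}].

Fact l2_null_zmod_closed : zmod_closed l2_null.
Proof.
split=> [|f g]; rewrite !inE /=; first exact: aeW.
by apply: filterS2 => x f0 g0; rewrite [LHS](_ : _ = f x - g x)// f0 g0 subrr.
Qed.
HB.instance Definition _ :=
  GRing.isZmodClosed.Build L2fun l2_null l2_null_zmod_closed.

(* Classes of square-integrable measurable functions modulo equality almost
   everywhere.  The operations below are computed on a chosen representative of
   the class; up to [l2_null] they do not depend on that choice. *)
Definition L2 : Type := (Quotient.quot l2_null).
HB.instance Definition _ := GRing.Zmodule.on L2.

Local Open Scope quotient_scope.

Definition L2class (h : L2fun) : L2 := \pi_(Quotient.quot l2_null) h.

Definition L2repr (h : L2) : L2fun := repr (h : (Quotient.quot l2_null)).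

Fact l2_fun_rmul (h : L2fun) (q : quat R) : (fun x => h x * q) \in l2_fun.
Proof.
have := L2fun_valP h; rewrite !inE /= => -[mh h2]; split.
  have [h0 h1 h3 h4] := measurable_components mh.
  apply: measurable_quat => /=;
  by repeat (apply: measurable_funB || apply: measurable_funD);
    apply: measurable_funM.
rewrite (eq_integral (fun x => (`|q| ^+ 2)%:E * (`|h x| ^+ 2)%:E)%E); last first.
  by move=> x _; rewrite quat_normM exprMn mulrC EFinM.
rewrite (ge0_integralZl_EFin _ _ _ (measurable_sqr_norm mh)) ?sqr_ge0//.
by rewrite lte_mul_pinfty ?lee_fin ?sqr_ge0.
Qed.

Definition L2rmul (h : L2) (q : quat R) : L2 :=
  L2class (MkL2fun (l2_fun_rmul (L2repr h) q)).

(* Componentwise Lebesgue integral of a quaternion-valued function. *)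
Definition quat_integral (F : T -> quat R) : quat R := Quat
  (Rintegral mu setT (@qre R \o F)) (Rintegral mu setT (@qi R \o F))
  (Rintegral mu setT (@qj R \o F)) (Rintegral mu setT (@qk R \o F)).

Definition L2inner (h k : L2) : quat R :=
  quat_integral (fun x => quat_conj (L2repr k x) * L2repr h x).

End L2.

Section Ray.
Context {R : realType} (f : quat R).

Definition imaginary_unit : Prop := qre f = 0 /\ `|f| = 1.

(* f_+ = {t f | t >= 0} as a subset of the quaternions; [ray f] is the same set
   as a type, with the subspace topology and its Borel sigma-algebra. *)
Definition halfline : set (quat R) := [set t *: f | t in [set t : R | 0 <= t]].

Definition ray : Type := set_type halfline.

HB.instance Definition _ := Topological.on ray.

Fact halfline0 : 0 \in halfline.
Proof. by rewrite inE; exists 0 => //=; rewrite scale0r. Qed.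
HB.instance Definition _ := isPointed.Build ray (exist _ 0 halfline0).

HB.instance Definition _ :=
  Measurable.copy ray (g_sigma_algebraType (@open ray)).

Definition ray_val (x : ray) : quat R := sval x.

Definition ray_itv (a b : R) : set ray :=
  [set x | exists2 t : R, a <= t <= b & ray_val x = t *: f].

End Ray.

Arguments ray_itv {R} f a b.

(* The norm and the completeness come from the underlying complete real normed
   module; [innerC] and [inner_norm] make [inner] hermitian, positive definite
   and the source of that norm, and [ract_real] identifies the real scaling of
   the normed module with the right action of the real quaternions. *)
HB.mixin Record isHilbertBimodule (R : realType) V
    & CompleteNormedModule R V := {
  lact : quat R -> V -> V;
  ract : V -> quat R -> V;
  inner : V -> V -> quat R;
  lactA : forall p q x, lact (p * q) x = lact p (lact q x);
  lact1 : forall x, lact 1 x = x;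
  lactDl : forall p q x, lact (p + q) x = lact p x + lact q x;
  lactDr : forall q x y, lact q (x + y) = lact q x + lact q y;
  ractA : forall x p q, ract x (p * q) = ract (ract x p) q;
  ract1 : forall x, ract x 1 = x;
  ractDr : forall x p q, ract x (p + q) = ract x p + ract x q;
  ractDl : forall x y q, ract (x + y) q = ract x q + ract y q;
  lract : forall p x q, ract (lact p x) q = lact p (ract x q);
  ract_real : forall x (a : R), ract x a%:A = a *: x;
  innerDl : forall x y z, inner (x + y) z = inner x z + inner y z;
  innerC : forall x y, inner y x = quat_conj (inner x y);
  inner_ractl : forall x y q, inner (ract x q) y = inner x y * q;
  inner_ractr : forall x y q, inner x (ract y q) = quat_conj q * inner x y;
  inner_norm : forall x, inner x x = (`|x| ^+ 2)%:A
}.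

#[short(type="hilbertBimodType")]
HB.structure Definition HilbertBimodule (R : realType) :=
  {V of isHilbertBimodule R V & CompleteNormedModule R V}.

(* An operator with domain [dom]; its values outside [dom] are irrelevant. *)
Record partial_op (V : Type) := PartialOp {
  dom : set V;
  app :> V -> V }.

Definition op_eq V (A B : partial_op V) : Prop :=
  dom A = dom B /\ forall x, dom A x -> A x = B x.

Section Operators.
Context {R : realType} {H : hilbertBimodType R}.
Implicit Types (A : partial_op H) (P : H -> H).

Definition right_linear A : Prop :=
  [/\ dom A 0,
      forall x y, dom A x -> dom A y -> dom A (x + y) /\ A (x + y) = A x + A y &
      forall x q, dom A x -> dom A (ract x q) /\ A (ract x q) = ract (A x) q].

Definition op_opp A := PartialOp (dom A) (fun x => - A x).

Definition adjoint_rel A (y z : H) : Prop :=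
  forall x, dom A x -> inner (A x) y = inner x z.

(* The value of [adjoint A] is unique as soon as [A] is densely defined. *)
Definition adjoint A := PartialOp
  [set y | exists z, adjoint_rel A y z]
  (fun y => xget 0 [set z | adjoint_rel A y z]).

Definition skew_selfadjoint A : Prop :=
  [/\ right_linear A, dense (dom A) & op_eq (adjoint A) (op_opp A)].

Definition total_op P := PartialOp setT P.

Definition bounded_op P : Prop := exists M : R, forall x, `|P x| <= M * `|x|.

Definition orth_proj P : Prop :=
  [/\ right_linear (total_op P), forall x, P (P x) = P x &
      forall x y, inner (P x) y = inner x (P y)].

Definition right_span (S : set H) : set H :=
  [set x | exists2 s : seq (H * quat R), {in s, forall p, S p.1} &
     x = \sum_(p <- s) ract p.1 p.2].

End Operators.

Section Spectral.
Context {R : realType} {f : quat R} {H : hilbertBimodType R}.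
Implicit Types (E : set (ray f) -> H -> H) (J : H -> H) (A : partial_op H).

Record spectral_measure E : Prop := SpectralMeasure {
  spectral_proj : forall D, measurable D -> orth_proj (E D);
  spectralT : forall h, E setT h = h;
  spectralI : forall D D', measurable D -> measurable D' ->
    forall h, E (D `&` D') h = E D (E D' h);
  spectral_sigma : forall F : (set (ray f))^nat,
    (forall n, measurable (F n)) -> trivIset setT F ->
    forall h, (fun n => \sum_(0 <= i < n) E (F i) h) @ \oo -->
              E (\bigcup_i F i) h }.

(* The set function D |-> <E(D)h, h>, which is real valued. *)
Definition spectral_mass E (h : H) (D : set (ray f)) : \bar R :=
  (qre (inner (E D h) h))%:E.

(* v is the integral over D of R_(phi q) J E(dq) h: the limit of the sums
   sum_k R_(phi (q_k)) J E(P_k) h over finite measurable partitions (P_k) of D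
   with tags q_k in P_k, as the oscillation of phi on the P_k tends to 0. *)
Definition is_spectral_integral E J (phi : ray f -> quat R)
    (D : set (ray f)) (h v : H) : Prop :=
  forall e : R, 0 < e -> exists2 delta : R, 0 < delta &
  forall n (P : 'I_n -> set (ray f)) (q : 'I_n -> ray f),
    (forall k, measurable (P k)) -> trivIset setT P ->
    \bigcup_k P k = D -> (forall k, P k (q k)) ->
    (forall k x, P k x -> `|phi x - phi (q k)| < delta) ->
    `|v - \sum_(k < n) ract (J (E (P k) h)) (phi (q k))| < e.

Record spectral_pair A E J : Prop := SpectralPair {
  sp_measure : spectral_measure E;
  sp_bounded : bounded_op J;
  sp_skew : skew_selfadjoint (total_op J);
  sp_comm : forall D, measurable D -> forall h, J (E D h) = E D (J h);
  sp_sqr : forall h, J (J h) = - h;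
  sp_dom : dom A = [set h |
    (\int[spectral_mass E h]_q (`|ray_val q| ^+ 2)%:E < +oo)%E];
  sp_app : forall h, dom A h -> exists2 v : H^nat,
    forall n, is_spectral_integral E J (fun q => - (ray_val q * f))
                (ray_itv f 0 n%:R) h (v n) &
    v @ \oo --> A h }.

(* The intervals are the [af, bf] with 0 <= a < b. *)
Definition generating_vector E (g : H) : Prop :=
  closure (right_span [set E (ray_itv f ab.1 ab.2) g |
                         ab in [set ab : R * R | 0 <= ab.1 < ab.2]]) = setT.

Definition simple_spectrum E : Prop := exists g, generating_vector E g.

End Spectral.

Section MulOp.
Context {R : realType} {f : quat R}.
Variable sigma : {measure set (ray f) -> \bar R}.

(* [insubd 0] only fills in a value outside the domain: for h in the domain,
   x |-> x * h x is square integrable. *)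
Definition mul_op : partial_op (L2 sigma) := PartialOp
  [set h : L2 sigma |
    (\int[sigma]_x (`|ray_val x| ^+ 2 * `|L2repr h x| ^+ 2)%:E < +oo)%E]
  (fun h => L2class (insubd 0 (fun x => ray_val x * L2repr h x))).

End MulOp.

Section UnitaryEquivalence.
Context {R : realType} {d} {T : measurableType d}
  {mu : {measure set T -> \bar R}} {H : hilbertBimodType R}.

Record unitary_map (Phi : L2 mu -> H) : Prop := UnitaryMap {
  unitaryD : forall h k, Phi (h + k) = Phi h + Phi k;
  unitary_rmul : forall h q, Phi (L2rmul h q) = ract (Phi h) q;
  unitary_inner : forall h k, inner (Phi h) (Phi k) = L2inner h k;
  unitary_surj : forall x, exists h, Phi h = x }.

Definition unitarily_equivalent (A : partial_op H) (Q : partial_op (L2 mu)) :=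
  exists Phi : L2 mu -> H,
    [/\ unitary_map Phi, dom A = Phi @` dom Q &
        forall h, dom Q h -> A (Phi h) = Phi (Q h)].

End UnitaryEquivalence.

(* Main.v *)
Require Import Defs.
From HB Require Import structures.
From mathcomp Require Import finmap.
From mathcomp Require Import all_boot all_order all_algebra.
From mathcomp Require Import all_classical all_reals all_analysis.
From mathcomp Require Import measurable_realfun generic_quotient ring_quotient.
From mathcomp Require Import ring lra.

(** Fix a generating vector g and let sigma(D) = <E(D)g, g>, a finite measure
    on the ray.  Sending 1_D q to E(D)g q preserves inner products, because
    <E(D)g, E(D')g> = sigma(D cap D') ([re_dot_step]).  Combinations of such
    functions are dense in L^2(sigma), their images are dense in H because g
    is generating, and both spaces are complete ([l2_complete]); so the
    correspondence extends to a unitary map U from L^2(sigma) onto H.  It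
    appears below through its graph [model], which is total on both sides
    ([model_total], [model_surj]).

    Under U the projection E(D) becomes multiplication by 1_D
    ([model_spectral]).  Put j = U^-1(Jg).  Since J is right linear and
    commutes with E, it becomes left multiplication by the function j
    ([model_skew]), and since J is skew and isometric, j(t) is almost
    everywhere an imaginary unit ([model_skew_symbol]).  On the point tau f of
    the ray the symbol of A is tau, so A becomes left multiplication by tau j
    ([model_symbol_cvg]), on the functions h for which tau h is square
    integrable, because <E(D)Uh, Uh> is the integral of |h|^2 over D
    ([integral_spectral_mass]).

    The operator Q multiplies by tau f instead of tau j.  All imaginary units
    are conjugate in the quaternions, and the conjugating unit can be chosen
    measurably: there is a measurable u with |u| = 1 and u f = j u
    ([measurable_alignment]).  Left multiplication by u is unitary, and
    Phi h = U(u h) ([twisted_map]) intertwines Q and A, since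
    u (tau f) = (tau j) u. *)

Set Implicit Arguments.
Unset Strict Implicit.
Unset Printing Implicit Defensive.

Import Order.TTheory GRing.Theory Num.Theory.
Import numFieldNormedType.Exports.

Local Open Scope classical_set_scope.
Local Open Scope ring_scope.

(** * Quaternions and quaternion-valued measurable functions *)

Section QuatExtra.
Context {R : realType}.
Implicit Types p q r : quat R.

Lemma quat_sqnormM_conj q : quat_conj q * q = (`|q| ^+ 2)%:A.
Proof. by rewrite sqr_quat_norm; apply: quatP => /=; rewrite /quat_sqnorm; ring. Qed.

Lemma quat_conjK q : quat_conj (quat_conj q) = q.
Proof. by apply: quatP => /=; ring. Qed.

Lemma quat_conjM p q : quat_conj (p * q) = quat_conj q * quat_conj p.
Proof. by apply: quatP => /=; ring. Qed.

Lemma quat_norm_conj q : `|quat_conj q| = `|q|.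
Proof. by rewrite !quat_normE; congr Num.sqrt; rewrite /quat_sqnorm /=; ring. Qed.

Lemma quat_norm_real (a : R) : `|a%:A : quat R| = `|a|.
Proof.
rewrite quat_normE -sqrtr_sqr; congr Num.sqrt.
by rewrite /quat_sqnorm /=; ring.
Qed.

Lemma quat_norm_le_sum q : `|q| <= `|qre q| + `|qi q| + `|qj q| + `|qk q|.
Proof.
have h (a b c d : R) : `|Quat a b c d| <= `|a| + `|b| + `|c| + `|d|.
  have -> : Quat a b c d = a%:A + b *: Quat 0 1 0 0 + c *: Quat 0 0 1 0
      + d *: Quat 0 0 0 1 by apply: quatP => /=; ring.
  rewrite (le_trans (ler_normD _ _))// lerD//; last first.
    by rewrite normrZ quat_normE /quat_sqnorm/= !expr0n/= expr1n !add0r sqrtr1 mulr1.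
  rewrite (le_trans (ler_normD _ _))// lerD//; last first.
    by rewrite normrZ quat_normE /quat_sqnorm/= !expr0n/= expr1n !add0r !addr0 sqrtr1 mulr1.
  rewrite (le_trans (ler_normD _ _))// lerD//; last first.
    by rewrite normrZ quat_normE /quat_sqnorm/= !expr0n/= expr1n !add0r !addr0 sqrtr1 mulr1.
  by rewrite normrZ quat_normE /quat_sqnorm/= !expr0n/= expr1n !addr0 sqrtr1 mulr1.
by case: q.
Qed.

End QuatExtra.

Section QuatMeasurableExtra.
Context {R : realType} d (T : measurableType d).
Implicit Types h k : T -> quat R.

Lemma measurable_quatD h k : measurable_fun setT h -> measurable_fun setT k ->
  measurable_fun setT (fun x => h x + k x).
Proof.
move=> /measurable_components[h0 h1 h2 h3] /measurable_components[k0 k1 k2 k3].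
by apply: measurable_quat; apply: measurable_funD.
Qed.

Lemma measurable_quatB h k : measurable_fun setT h -> measurable_fun setT k ->
  measurable_fun setT (fun x => h x - k x).
Proof.
move=> /measurable_components[h0 h1 h2 h3] /measurable_components[k0 k1 k2 k3].
by apply: measurable_quat; apply: measurable_funB.
Qed.

Lemma measurable_quatM h k : measurable_fun setT h -> measurable_fun setT k ->
  measurable_fun setT (fun x => h x * k x).
Proof.
move=> /measurable_components[h0 h1 h2 h3] /measurable_components[k0 k1 k2 k3].
by apply: measurable_quat => /=;
  repeat (apply: measurable_funB || apply: measurable_funD);
  apply: measurable_funM.
Qed.

Lemma measurable_quatZ (a : T -> R) k : measurable_fun setT a ->
  measurable_fun setT k -> measurable_fun setT (fun x => a x *: k x).
Proof.
move=> ma /measurable_components[k0 k1 k2 k3].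
by apply: measurable_quat => /=; apply: measurable_funM.
Qed.

Lemma measurable_quat_conj h : measurable_fun setT h ->
  measurable_fun setT (fun x => quat_conj (h x)).
Proof.
move=> /measurable_components[h0 h1 h2 h3].
have mN (u : T -> R) : measurable_fun setT u -> measurable_fun setT (fun x => - u x).
  exact: measurableT_comp.
by apply: measurable_quat; [exact: h0|exact: mN|exact: mN|exact: mN].
Qed.

Lemma measurable_quat_norm h : measurable_fun setT h ->
  measurable_fun setT (fun x => `|h x|).
Proof.
have -> : (fun x => `|h x|) = (fun y : R => y `^ (2^-1)) \o
    (fun x => `|h x| ^+ 2).
  by apply/funext => x /=; rewrite powR12_sqrt ?sqr_ge0// sqrtr_sqr normr_id.
move=> /measurable_sqr_norm /measurable_EFinP mh.
exact: measurableT_comp (measurable_powR _) mh.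
Qed.

Lemma measurable_quat_indic (D : set T) h : measurable D ->
  measurable_fun setT h -> measurable_fun setT (fun x => \1_D x *: h x).
Proof. by move=> mD; apply: measurable_quatZ. Qed.

End QuatMeasurableExtra.

(** * The L2 seminorm of quaternion-valued functions *)
Section L2norm.
Context {R : realType} {d} {T : measurableType d}.
Variable mu : {measure set T -> \bar R}.
Implicit Types h k : T -> quat R.

Definition sqint h : \bar R := \int[mu]_x (`|h x| ^+ 2)%:E.

Definition l2norm h : R := Num.sqrt (fine (sqint h)).

Lemma l2P h : h \in l2_fun mu <-> measurable_fun setT h /\ (sqint h < +oo)%E.
Proof. by rewrite inE. Qed.

Lemma l2_measurable h : h \in l2_fun mu -> measurable_fun setT h.
Proof. by move=> /l2P[]. Qed.

Lemma sqint_ge0 h : (0 <= sqint h)%E.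
Proof. by apply: integral_ge0 => x _; rewrite lee_fin sqr_ge0. Qed.

Lemma l2norm_ge0 h : 0 <= l2norm h. Proof. exact: sqrtr_ge0. Qed.

Lemma l2norm0 : l2norm 0 = 0.
Proof.
rewrite /l2norm [sqint _](_ : _ = 0%E) ?sqrtr0//.
by apply: integral0_eq => x _; rewrite [X in `|X|](_ : _ = 0)// normr0 expr0n.
Qed.

Lemma sqr_l2norm h : h \in l2_fun mu -> (l2norm h ^+ 2)%:E = sqint h.
Proof.
move=> /l2P[_ hoo]; rewrite /l2norm sqr_sqrtr ?fine_ge0 ?sqint_ge0// fineK//.
by rewrite ge0_fin_numE ?sqint_ge0.
Qed.

Lemma sqint_le (c : R) h k : measurable_fun setT h -> measurable_fun setT k ->
  (forall x, `|h x| <= c * `|k x|) -> (sqint h <= (c ^+ 2)%:E * sqint k)%E.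
Proof.
move=> mh mk hk.
rewrite -ge0_integralZl_EFin ?sqr_ge0//; last exact: measurable_sqr_norm.
apply: ge0_le_integral => //.
- exact: measurable_sqr_norm.
- by apply: measurable_funeM; exact: measurable_sqr_norm.
move=> x _; rewrite lee_fin -exprMn lerXn2r ?nnegrE// (le_trans _ (hk x))//.
Qed.

Lemma l2_le (c : R) h k : measurable_fun setT h -> k \in l2_fun mu ->
  (forall x, `|h x| <= c * `|k x|) -> h \in l2_fun mu.
Proof.
move=> mh /l2P[mk koo] hk; apply/l2P; split => //.
by rewrite (le_lt_trans (sqint_le mh mk hk))// lte_mul_pinfty// lee_fin sqr_ge0.
Qed.

Lemma l2norm_le (c : R) h k : 0 <= c -> measurable_fun setT h -> k \in l2_fun mu ->
  (forall x, `|h x| <= c * `|k x|) -> l2norm h <= c * l2norm k.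
Proof.
move=> c0 mh lk hk; have lh := l2_le mh lk hk.
rewrite -(@ler_pXn2r _ 2) ?nnegrE ?mulr_ge0 ?l2norm_ge0//.
rewrite exprMn -lee_fin [leRHS]EFinM !sqr_l2norm//; apply: sqint_le => //.
exact: l2_measurable.
Qed.

(** Expressing the seminorm by the real function |h| makes Minkowski's
    inequality for real functions available. *)
Lemma l2norm_Lnorm h : h \in l2_fun mu ->
  (l2norm h)%:E = Lnorm mu 2%:E (fun x => (`|h x|)%:E).
Proof.
move=> lh; rewrite unlock.
have -> : (\int[mu]_x (`|(`|h x|)%:E| `^ 2))%E = sqint h.
  apply: eq_integral => x _; rewrite abse_EFin normr_id poweR_EFin.
  by rewrite powR_mulrn.
rewrite -sqr_l2norm// poweR_EFin powR12_sqrt ?sqr_ge0// sqrtr_sqr ger0_norm//.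
exact: l2norm_ge0.
Qed.

(** The quaternions |h(x)| and |k(x)| are real and nonnegative, so their sum
    has norm |h(x)| + |k(x)|, which dominates |h(x) + k(x)|; for |h| + |k| the
    inequality is Minkowski's. *)
Lemma l2norm_triangle h k : h \in l2_fun mu -> k \in l2_fun mu ->
  l2norm (h + k) <= l2norm h + l2norm k.
Proof.
move=> lh lk; have lhk := rpredD lh lk.
pose a (u : T -> quat R) : T -> quat R := fun x => (`|u x|)%:A.
have na u x : `|a u x| = `|u x| by rewrite quat_norm_real normr_id.
have ma u : measurable_fun setT u -> measurable_fun setT (a u).
  move=> mu0; apply: (measurable_quatZ (k := cst 1)) => //.
  exact: measurable_quat_norm.
have la u : u \in l2_fun mu -> a u \in l2_fun mu.
  move=> lu; apply: (@l2_le 1 _ u) => // [|x]; last by rewrite na mul1r.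
  exact/ma/l2_measurable.
have lw : a h + a k \in l2_fun mu by rewrite rpredD ?la.
have nw x : `|(a h + a k) x| = `|h x| + `|k x|.
  rewrite [X in `|X|](_ : _ = (`|h x| + `|k x|)%:A); last by rewrite scalerDl.
  by rewrite quat_norm_real ger0_norm// addr_ge0.
rewrite (@le_trans _ _ (l2norm (a h + a k)))//.
  rewrite -[leRHS]mul1r; apply: l2norm_le => // [|x]; first exact: l2_measurable.
  by rewrite mul1r nw ler_normD.
have mn u : u \in l2_fun mu -> measurable_fun setT (fun x => `|u x|).
  by move=> /l2_measurable; exact: measurable_quat_norm.
rewrite -lee_fin EFinD !l2norm_Lnorm//.
have -> : (fun x => (`|(a h + a k) x|)%:E) =
    EFin \o ((fun x => `|h x|) \+ (fun x => `|k x|)).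
  by apply/funext => x /=; rewrite nw.
by apply: minkowski_EFin; [exact: mn|exact: mn|rewrite ler1n].
Qed.

Lemma l2norm_eq h k : sqint h = sqint k -> l2norm h = l2norm k.
Proof. by rewrite /l2norm => ->. Qed.

Lemma l2normN h : l2norm (- h) = l2norm h.
Proof.
by apply: l2norm_eq; apply: eq_integral => x _; rewrite [(- h) x](_ : _ = - h x)// normrN.
Qed.

Lemma l2norm_triangleB h k : h \in l2_fun mu -> k \in l2_fun mu ->
  l2norm (h - k) <= l2norm h + l2norm k.
Proof. by move=> lh lk; rewrite -(l2normN k) l2norm_triangle// rpredN. Qed.

Lemma ae_sqint h k : measurable_fun setT h -> measurable_fun setT k ->
  {ae mu, forall x, h x = k x} -> sqint h = sqint k.
Proof.
move=> mh mk hk; apply: ge0_ae_eq_integral => //; try exact: measurable_sqr_norm.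
by apply: filterS hk => x -> _.
Qed.

Lemma l2_ae h k : measurable_fun setT h -> k \in l2_fun mu ->
  {ae mu, forall x, h x = k x} -> h \in l2_fun mu.
Proof.
move=> mh lk hk; apply/l2P; split=> //.
by rewrite (ae_sqint mh _ hk); move/l2P : lk => [].
Qed.

Lemma l2_rmul h q : h \in l2_fun mu -> (fun x => h x * q) \in l2_fun mu.
Proof. by move=> lh; exact: (l2_fun_rmul (MkL2fun lh)). Qed.

Lemma l2norm_rmul h q : h \in l2_fun mu ->
  l2norm (fun x => h x * q) <= `|q| * l2norm h.
Proof.
move=> lh; apply: l2norm_le => // [|x]; last by rewrite quat_normM mulrC.
exact/l2_measurable/l2_rmul.
Qed.

(** The integrable majorant of |F n|^2 is |h|^2. *)
Lemma l2norm_dominated_cvg0 h (F : (T -> quat R)^nat) : h \in l2_fun mu ->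
  (forall n, measurable_fun setT (F n)) -> (forall n x, `|F n x| <= `|h x|) ->
  (forall x, (fun n => `|F n x|) @ \oo --> (0 : R)) ->
  (fun n => l2norm (F n)) @ \oo --> (0 : R).
Proof.
move=> lh mF Fh F0.
have lF n : F n \in l2_fun mu.
  by apply: (@l2_le 1 _ h) => // x; rewrite mul1r.
have [] := @dominated_convergence _ T R mu setT measurableT
  (fun n x => (`|F n x| ^+ 2)%:E) (cst 0%E) (fun x => (`|h x| ^+ 2)%:E).
- by move=> n; exact: measurable_sqr_norm.
- exact: measurable_cst.
- apply: aeW => x _; apply/fine_cvgP; split; first exact: nearW.
  rewrite [X in X @ _ --> _](_ : _ = (fun n => `|F n x| * `|F n x|)); last first.
    by apply/funext => n /=; rewrite expr2.
  by rewrite -(mulr0 0); apply: cvgM.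
- apply/integrableP; split; first exact/measurable_sqr_norm/l2_measurable.
  under eq_integral do rewrite gee0_abs ?lee_fin ?sqr_ge0//.
  by move/l2P : lh => [].
- apply: aeW => x n _ /=; rewrite lee_fin ger0_norm ?sqr_ge0// lerXn2r ?nnegrE//.
move=> _ _; rewrite integral0 => /fine_cvgP[_ F20].
apply: (cvg_trans _ (_ : (fun n => Num.sqrt (l2norm (F n) ^+ 2)) @ \oo --> (0:R))).
  by apply: near_eq_cvg; near=> n; rewrite /= sqrtr_sqr ger0_norm ?l2norm_ge0.
rewrite -sqrtr0; apply: continuous_cvg; first exact: sqrt_continuous.
apply: cvg_trans F20; apply: near_eq_cvg; near=> n => /=.
by rewrite -[LHS]/(fine (sqint (F n))) -sqr_l2norm.
Unshelve. all: by end_near. Qed.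

End L2norm.

(** * Completeness of L2 *)

Section SummableSteps.
Context {R : realType} {V : completeNormedModType R}.

Lemma dist_le_sum_steps (u : V^nat) (G : R^nat) n m : (n <= m)%N ->
  (forall k, `|u k.+1 - u k| <= G k) -> `|u m - u n| <= \sum_(n <= k < m) G k.
Proof.
move=> nm uG; rewrite -(telescope_sumr _ nm) (le_trans (ler_norm_sum _ _ _))//.
by apply: ler_sum => k _; exact: uG.
Qed.

(** The bound on |lim u - u n| is uniform in n: it serves as an integrable
    majorant when the terms depend on a parameter. *)
Lemma cvg_summable_steps (u : V^nat) (G : R^nat) (s : R) :
  (forall k, `|u k.+1 - u k| <= G k) ->
  (forall n, \sum_(0 <= k < n) G k <= s) ->
  cvgn u /\ forall n, `|limn u - u n| <= s.
Proof.
move=> uG Gs; have G0 k : 0 <= G k by rewrite (le_trans _ (uG k)).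
have cu : cvgn u.
  have : cvgn (series (telescope u)).
    apply: normed_cvg; apply: nondecreasing_is_cvgn.
      apply: nondecreasing_series => // n _ _; exact: normr_ge0.
    exists s => _ [n _ <-]; rewrite (le_trans _ (Gs n))//.
    by rewrite /series /=; apply: ler_sum => k _; exact: uG.
  rewrite telescopeK => cu.
  have -> : u = (fun n => u n - u 0%N) \+ cst (u 0%N).
    by apply/funext => n /=; rewrite subrK.
  by apply: is_cvgD => //; exact: is_cvg_cst.
split=> // n; have cun : (fun m => `|u m - u n|) @ \oo --> `|limn u - u n|.
  by apply: cvg_norm; apply: cvgB => //; exact: cvg_cst.
apply: (cvgr_to_le cun); near=> m.
have nm : (n <= m)%N by near: m; exact: nbhs_infty_ge.
rewrite (le_trans (dist_le_sum_steps nm uG))// (le_trans _ (Gs m))//.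
rewrite [leRHS](big_cat_nat (n := n))//= lerDr.
by rewrite sumr_ge0.
Unshelve. all: by end_near. Qed.

End SummableSteps.

Section HalfPowers.
Context {R : realType}.

Lemma sum_half_pow_le n : \sum_(0 <= k < n) (2^-1 : R) ^+ k <= 2.
Proof.
have -> : \sum_(0 <= k < n) (2^-1 : R) ^+ k = 2 - 2 * 2^-1 ^+ n.
  elim: n => [|n IH]; first by rewrite big_nil expr0; lra.
  by rewrite big_nat_recr//= IH exprS; lra.
by rewrite gerBl mulr_ge0// exprn_ge0.
Qed.

Lemma cvg_half_pow : (fun n => (2^-1 : R) ^+ n) @ \oo --> (0 : R).
Proof. by apply: cvg_expr; rewrite ger0_norm//; lra. Qed.

Lemma half_pow_gt0 n : 0 < (2^-1 : R) ^+ n / 2.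
Proof. by rewrite divr_gt0// exprn_gt0. Qed.

End HalfPowers.

Section QuatLimit.
Context {R : realType}.

Lemma quat_limit (u : (quat R)^nat) (G : R^nat) (s : R) :
  (forall k, `|u k.+1 - u k| <= G k) ->
  (forall n, \sum_(0 <= k < n) G k <= s) ->
  exists l : quat R, [/\ (fun n => qre (u n)) @ \oo --> qre l,
    (fun n => qi (u n)) @ \oo --> qi l, (fun n => qj (u n)) @ \oo --> qj l,
    (fun n => qk (u n)) @ \oo --> qk l &
    (forall n, `|l - u n| <= 4 * s)].
Proof.
move=> uG Gs.
have [c0 b0] : cvgn (@qre R \o u) /\ forall n, `|limn (@qre R \o u) - qre (u n)| <= s.
  apply: (@cvg_summable_steps R R (@qre R \o u) G) => // k.
  by apply: le_trans (uG k); have [] := ler_norm_components (u k.+1 - u k).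
have [c1 b1] : cvgn (@qi R \o u) /\ forall n, `|limn (@qi R \o u) - qi (u n)| <= s.
  apply: (@cvg_summable_steps R R (@qi R \o u) G) => // k.
  by apply: le_trans (uG k); have [] := ler_norm_components (u k.+1 - u k).
have [c2 b2] : cvgn (@qj R \o u) /\ forall n, `|limn (@qj R \o u) - qj (u n)| <= s.
  apply: (@cvg_summable_steps R R (@qj R \o u) G) => // k.
  by apply: le_trans (uG k); have [] := ler_norm_components (u k.+1 - u k).
have [c3 b3] : cvgn (@qk R \o u) /\ forall n, `|limn (@qk R \o u) - qk (u n)| <= s.
  apply: (@cvg_summable_steps R R (@qk R \o u) G) => // k.
  by apply: le_trans (uG k); have [] := ler_norm_components (u k.+1 - u k).
exists (Quat (limn (@qre R \o u)) (limn (@qi R \o u)) (limn (@qj R \o u))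
  (limn (@qk R \o u))); split => // n.
rewrite (le_trans (quat_norm_le_sum _))//=.
by move: (b0 n) (b1 n) (b2 n) (b3 n); lra.
Qed.

Lemma quat_cvg0 (u : (quat R)^nat) (l : quat R) : (fun n => qre (u n)) @ \oo --> qre l ->
    (fun n => qi (u n)) @ \oo --> qi l -> (fun n => qj (u n)) @ \oo --> qj l ->
    (fun n => qk (u n)) @ \oo --> qk l -> (fun n => `|l - u n|) @ \oo --> (0 : R).
Proof.
move=> c0 c1 c2 c3.
apply: (@squeeze_cvgr _ _ _ _ (cst 0) (fun n => `|qre l - qre (u n)| +
   `|qi l - qi (u n)| + `|qj l - qj (u n)| + `|qk l - qk (u n)|)).
- by near=> n; rewrite normr_ge0/= (le_trans (quat_norm_le_sum _)).
- exact: cvg_cst.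
have Z (v : R^nat) a : v @ \oo --> a -> (fun n => `|a - v n|) @ \oo --> (0 : R).
  move=> va; rewrite -(normr0 R) -(subrr a).
  by apply: cvg_norm; apply: cvgB => //; exact: cvg_cst.
have := cvgD (cvgD (cvgD (Z _ _ c0) (Z _ _ c1)) (Z _ _ c2)) (Z _ _ c3).
by rewrite !addr0; apply.
Unshelve. all: by end_near. Qed.

End QuatLimit.

Section L2complete.
Context {R : realType} {d} {T : measurableType d}.
Variable mu : {measure set T -> \bar R}.

Lemma l2norm_sum (I : Type) (r : seq I) (F : I -> T -> quat R) :
  (forall i, F i \in l2_fun mu) ->
  l2norm mu (\sum_(i <- r) F i) <= \sum_(i <- r) l2norm mu (F i).
Proof.
move=> lF; elim: r => [|i r IH].
  by rewrite !big_nil l2norm0.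
rewrite !big_cons (le_trans (l2norm_triangle _ _))// ?rpred_sum//.
by rewrite lerD2l.
Qed.

(** Riesz-Fischer for a sequence with geometrically small steps.  The partial
    sums g N of the step lengths |F (n+1) - F n| are increasing with seminorm
    at most 2, so by monotone convergence their limit is square integrable and
    finite almost everywhere.  Where it is finite F n x converges, and it
    bounds the distance from F n x to the limit up to the factor 4, which makes
    dominated convergence applicable. *)
Theorem l2_complete (F : (T -> quat R)^nat) : (forall n, F n \in l2_fun mu) ->
  (forall n, l2norm mu (F n.+1 - F n) <= 2^-1 ^+ n) ->
  exists2 h, h \in l2_fun mu & (fun n => l2norm mu (h - F n)) @ \oo --> (0 : R).
Proof.
move=> lF dF.
pose G n x := `|F n.+1 x - F n x|.
pose g N x := \sum_(0 <= k < N) G k x.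
have mF n := l2_measurable (lF n).
have mG n : measurable_fun setT (G n).
  by apply: measurable_quat_norm; exact: measurable_quatB.
have mg N : measurable_fun setT (g N) by apply: measurable_sum.
have g0 N x : 0 <= g N x by apply: sumr_ge0 => k _; exact: normr_ge0.
have ndg x : nondecreasing_seq (g ^~ x).
  by apply: nondecreasing_series => k _ _; exact: normr_ge0.
pose gq N : T -> quat R := fun x => (g N x)%:A.
have ngq N x : `|gq N x| = g N x by rewrite quat_norm_real ger0_norm.
pose Gq k : T -> quat R := fun x => (G k x)%:A.
have mGq k : measurable_fun setT (Gq k).
  by apply: (measurable_quatZ (k := cst 1)).
have lGq k : Gq k \in l2_fun mu.
  apply: (@l2_le _ _ _ mu 1 _ (F k.+1 - F k)) => //; first exact: rpredB.
  by move=> x; rewrite mul1r quat_norm_real normr_id.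
have gqE N : gq N = \sum_(0 <= k < N) Gq k.
  by apply/funext => x; rewrite fct_sumE /gq /g scaler_suml.
have lgq N : gq N \in l2_fun mu by rewrite gqE rpred_sum.
have bgq N : l2norm mu (gq N) <= 2.
  rewrite gqE (le_trans (l2norm_sum _ _))//.
  apply: (@le_trans _ _ (\sum_(0 <= k < N) (2^-1 : R) ^+ k)).
    apply: ler_sum => k _; apply: le_trans (dF k).
    rewrite -[leRHS]mul1r; apply: l2norm_le => //; first exact: rpredB.
    by move=> x; rewrite mul1r quat_norm_real normr_id.
  exact: sum_half_pow_le.
pose Q x := limn (fun N => (`|gq N x| ^+ 2)%:E).
have ndq x : nondecreasing_seq (fun N => (`|gq N x| ^+ 2)%:E).
  by move=> m n mn; rewrite lee_fin !ngq lerXn2r ?nnegrE// ndg.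
have cq x : cvgn (fun N => (`|gq N x| ^+ 2)%:E).
  exact: ereal_nondecreasing_is_cvgn.
have mgq N : measurable_fun setT (fun x => (`|gq N x| ^+ 2)%:E).
  by apply: measurable_sqr_norm; exact: l2_measurable.
have mQ : measurable_fun setT Q.
  by apply: (emeasurable_fun_cvg (fun N x => (`|gq N x| ^+ 2)%:E)) => // x _.
have Qub N x : ((`|gq N x| ^+ 2)%:E <= Q x)%E.
  apply: lime_ge => //; near=> M; apply: ndq.
  by near: M; exact: nbhs_infty_ge.
have Q0 x : (0 <= Q x)%E by apply: le_trans (Qub 0%N x); rewrite lee_fin sqr_ge0.
have iQ : (\int[mu]_x Q x <= 4%:E)%E.
  rewrite monotone_convergence//.
  apply: lime_le.
    apply: ereal_nondecreasing_is_cvgn => m n mn; apply: ge0_le_integral => //.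
    by move=> x _; exact: ndq.
  near=> n; rewrite -[X in (X <= _)%E]/(sqint mu (gq n)) -sqr_l2norm// lee_fin.
  rewrite (_ : 4 = 2 ^+ 2) ?lerXn2r ?nnegrE ?l2norm_ge0//; lra.
(* On B the step lengths are summable; off B the sequence is replaced by 0. *)
pose B := [set x | (Q x < +oo)%E].
have mB : measurable B.
  rewrite (_ : B = [set: T] `&` [set x | (Q x < +oo)%E]); last by rewrite setTI.
  exact: emeasurable_fun_infty_o.
have aeB : {ae mu, forall x, B x}.
  have : mu.-integrable setT Q.
    apply/integrableP; split => //; apply: le_lt_trans (ltry 4).
    by under eq_integral do rewrite gee0_abs//.
  move/(integrable_ae measurableT); apply: filterS => x /(_ Logic.I).
  by rewrite ge0_fin_numE.
pose F' n x := \1_B x *: F n x.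
have mF' n : measurable_fun setT (F' n) by exact: measurable_quat_indic.
have FF' n : {ae mu, forall x, F n x = F' n x}.
  by apply: filterS aeB => x Bx; rewrite /F' indicE mem_set// scale1r.
pose s x := \1_B x * Num.sqrt (fine (Q x)).
have gs x N : B x -> g N x <= s x.
  move=> Bx; rewrite /s indicE mem_set// mul1r.
  rewrite -[leLHS]ger0_norm// -sqrtr_sqr ler_wsqrtr//.
  rewrite -lee_fin fineK ?ge0_fin_numE// -(ngq N x) (le_trans (Qub N x))//.
have stepF' x n : `|F' n.+1 x - F' n x| <= \1_B x * G n x.
  by rewrite /F' -scalerBr normrZ ger0_norm ?indicE ?ler0n.
have sums x N : \sum_(0 <= k < N) (\1_B x * G k x) <= s x.
  rewrite -mulr_sumr; have [xB|xB] := boolP (x \in B).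
    by rewrite indicE xB mul1r gs//; exact/set_mem.
  by rewrite /s !indicE (negbTE xB) !mul0r.
pose h x := projT1 (cid (quat_limit (stepF' x) (sums x))).
have hP x : [/\ (fun n => qre (F' n x)) @ \oo --> qre (h x),
    (fun n => qi (F' n x)) @ \oo --> qi (h x), (fun n => qj (F' n x)) @ \oo --> qj (h x),
    (fun n => qk (F' n x)) @ \oo --> qk (h x) &
    (forall n, `|h x - F' n x| <= 4 * s x)].
  by rewrite /h; case: cid.
have mh : measurable_fun setT h.
  have mc n := measurable_components (mF' n).
  apply: measurable_quat.
  - apply: (@measurable_fun_cvg _ _ _ setT (fun n => @qre R \o F' n)) => [n|x _].
      by have [] := mc n.
    by have [] := hP x.
  - apply: (@measurable_fun_cvg _ _ _ setT (fun n => @qi R \o F' n)) => [n|x _].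
      by have [] := mc n.
    by have [] := hP x.
  - apply: (@measurable_fun_cvg _ _ _ setT (fun n => @qj R \o F' n)) => [n|x _].
      by have [] := mc n.
    by have [] := hP x.
  - apply: (@measurable_fun_cvg _ _ _ setT (fun n => @qk R \o F' n)) => [n|x _].
      by have [] := mc n.
    by have [] := hP x.
pose w : T -> quat R := fun x => (4 * s x)%:A.
have s0 x : 0 <= s x by rewrite mulr_ge0 ?sqrtr_ge0// indicE ler0n.
have nw x : `|w x| = 4 * s x by rewrite quat_norm_real ger0_norm// mulr_ge0.
have ms : measurable_fun setT s.
  apply: measurable_funM => //.
  rewrite [X in measurable_fun _ X](_ : _ = (fun y => y `^ (2^-1)) \o (fine \o Q)).
    by apply: measurableT_comp => //; exact: measurableT_comp.
  by apply/funext => x /=; rewrite powR12_sqrt// fine_ge0.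
have lw : w \in l2_fun mu.
  apply/l2P; split.
    apply: (measurable_quatZ (k := cst 1)) => //.
    by apply: measurable_funM.
  apply: (@le_lt_trans _ _ (\int[mu]_x (16%:E * Q x))%E).
    apply: ge0_le_integral => //.
    - apply/measurable_EFinP; rewrite (_ : (fun x => _) = fun x => (4 * s x) ^+ 2).
        by apply: measurable_funX; exact: measurable_funM.
      by apply/funext => x; rewrite nw.
    - exact: measurable_funeM.
    move=> x _; rewrite nw exprMn /s.
    have [xB|xB] := boolP (x \in B); last first.
      by rewrite indicE (negbTE xB) mul0r expr0n/= mulr0 mule_ge0.
    rewrite indicE xB mul1r sqr_sqrtr ?fine_ge0// EFinM fineK; last first.
      by rewrite ge0_fin_numE//; move/set_mem: xB.
    by rewrite lee_wpmul2r// lee_fin; lra.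
  rewrite ge0_integralZl_EFin// ?lte_mul_pinfty//.
  exact: le_lt_trans iQ (ltry _).
have lF' n : F' n \in l2_fun mu.
  by apply: l2_ae (lF n) _ => //; apply: filterS (FF' n).
have hF0 : (fun n => l2norm mu (h - F' n)) @ \oo --> (0 : R).
  apply: (l2norm_dominated_cvg0 lw).
  - by move=> n; exact: measurable_quatB.
  - by move=> n x; rewrite nw; have [_ _ _ _] := hP x; exact.
  - by move=> x; have [c0 c1 c2 c3 _] := hP x; exact: quat_cvg0 c0 c1 c2 c3.
exists h.
  have -> : h = (h - F' 0%N) + F' 0%N by rewrite subrK.
  rewrite rpredD//; apply: (@l2_le _ _ _ mu 1 _ w) => //.
    exact: measurable_quatB.
  by move=> x; rewrite mul1r nw; have [_ _ _ _] := hP x; exact.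
rewrite (_ : (fun n => _) = (fun n => l2norm mu (h - F' n)))//.
apply/funext => n; apply/l2norm_eq/ae_sqint; try exact: measurable_quatB.
by apply: filterS (FF' n) => x Fx; rewrite -[LHS]/(h x - F n x) Fx.
Unshelve. all: by end_near. Qed.

End L2complete.

(** * An induction principle for square-integrable functions *)

Section L2induction.
Context {R : realType} {d} {T : measurableType d}.
Variable mu : {finite_measure set T -> \bar R}.

Lemma l2_bounded (M : R) (h : T -> quat R) : measurable_fun setT h ->
  (forall x, `|h x| <= M) -> h \in l2_fun mu.
Proof.
move=> mh hM; apply/l2P; split => //.
apply: (@le_lt_trans _ _ (\int[mu]_x (M ^+ 2)%:E)%E).
  apply: ge0_le_integral => //.
  - exact: measurable_sqr_norm.
  - by move=> x _; rewrite lee_fin lerXn2r ?nnegrE// (le_trans _ (hM x)).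
by rewrite integral_cst// lte_mul_pinfty ?lee_fin ?sqr_ge0// ltey_eq fin_num_measure.
Qed.

Variable K : (T -> quat R) -> Prop.
Hypothesis K_indic : forall D q, measurable D -> K (fun x => \1_D x *: q).
Hypothesis KD : forall h k, h \in l2_fun mu -> k \in l2_fun mu ->
  K h -> K k -> K (h + k).
Hypothesis K_closed : forall h, h \in l2_fun mu ->
  (forall e : R, 0 < e ->
     exists k, [/\ k \in l2_fun mu, K k & l2norm mu (h - k) < e]) -> K h.

Let K0 : K 0.
Proof.
rewrite (_ : 0 = fun x => \1_set0 x *: 0); first exact: K_indic.
by apply/funext => x; rewrite scaler0.
Qed.

Let K_sum (I : Type) (r : seq I) (F : I -> T -> quat R) :
  (forall i, F i \in l2_fun mu) -> (forall i, K (F i)) -> K (\sum_(i <- r) F i).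
Proof.
move=> lF KF; elim: r => [|i r IH]; first by rewrite big_nil.
by rewrite big_cons; apply: KD => //; exact: rpred_sum.
Qed.

Import HBNNSimple.

Let K_nnsfun (a : {nnsfun T >-> R}) (q : quat R) : K (fun x => a x *: q).
Proof.
have -> : (fun x => a x *: q) =
  \sum_(y <- fset_set (range a)) (fun x => \1_(a @^-1` [set y]) x *: (y *: q)).
  apply/funext => x; rewrite fct_sumE {1}(fimfunE a x) fsbig_finite//= scaler_suml.
  by apply: eq_bigr => y _; rewrite scalerA mulrC.
apply: K_sum => y; last exact: K_indic.
apply: (@l2_bounded `|y *: q|).
  by apply: (measurable_quatZ (k := cst _)).
move=> x; rewrite normrZ ler_piMl// indicE ger0_norm ?ler0n//.
by case: (_ \in _).
Qed.

(** The increasing simple functions below a stay at distance at most a from a,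
    so dominated convergence gives convergence in the seminorm. *)
Let K_nonneg (a : T -> R) (q : quat R) : measurable_fun setT a ->
  (forall x, 0 <= a x) -> (fun x => a x *: q) \in l2_fun mu ->
  K (fun x => a x *: q).
Proof.
move=> ma a0 la; apply: K_closed => // e e0.
have mEa : measurable_fun setT (EFin \o a) by exact/measurable_EFinP.
pose s := nnsfun_approx measurableT mEa.
have cs x : (fun n => s n x) @ \oo --> a x.
  have /fine_cvgP[_] := @cvg_nnsfun_approx _ _ _ _ measurableT _ mEa
    (fun x _ => a0 x : (0 <= (EFin \o a) x)%E) x Logic.I.
  exact.
have sa n x : s n x <= a x.
  have nds : nondecreasing_seq (s ^~ x).
    by move=> m p mp; have /lefP := nd_nnsfun_approx measurableT mEa mp; exact.
  rewrite -(cvg_lim _ (cs x))//; apply: nondecreasing_cvgn_le => //.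
  by apply/cvg_ex; exists (a x).
have ms n : measurable_fun setT (fun x => s n x *: q).
  by apply: (measurable_quatZ (k := cst _)).
have c0 : (fun n => l2norm mu (fun x => (a x - s n x) *: q)) @ \oo --> (0 : R).
  apply: (l2norm_dominated_cvg0 la).
  - by move=> n; apply: (measurable_quatZ (k := cst _)) => //; exact: measurable_funB.
  - move=> n x; rewrite !normrZ ler_wpM2r// !ger0_norm ?subr_ge0//.
    by rewrite lerBlDr lerDl.
  - move=> x.
    have cM : (fun n => `|a x - s n x| * `|q|) @ \oo --> `|a x - a x| * `|q|.
      apply: cvgM; last exact: cvg_cst.
      by apply: cvg_norm; apply: cvgB => //; exact: cvg_cst.
    rewrite subrr normr0 mul0r in cM; apply: cvg_trans cM; apply: near_eq_cvg.
    by near=> n; rewrite normrZ.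
have [N _ /(_ N (leqnn N)) HN] := cvgr_lt _ c0 _ e0.
exists (fun x => s N x *: q); split => //.
  apply: (@l2_le _ _ _ _ 1 _ _ _ la) => // x.
  by rewrite mul1r !normrZ ler_wpM2r// !ger0_norm.
apply: le_lt_trans HN; rewrite le_eqVlt; apply/orP; left; apply/eqP.
by congr l2norm; apply/funext => x; rewrite scalerBl.
Unshelve. all: by end_near. Qed.

Let K_real (a : T -> R) (q : quat R) : measurable_fun setT a ->
  (fun x => a x *: q) \in l2_fun mu -> K (fun x => a x *: q).
Proof.
move=> ma la.
have -> : (fun x => a x *: q) = (fun x => a^\+ x *: q) + (fun x => a^\- x *: - q).
  apply/funext => x; rewrite -[RHS]/(_ *: _ + _ *: _) scalerN -scalerBl.
  by rewrite -{1}(funrposBneg a).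
have mp : measurable_fun setT a^\+ by exact: measurable_funrpos.
have mn : measurable_fun setT a^\- by exact: measurable_funrneg.
have lp : (fun x => a^\+ x *: q) \in l2_fun mu.
  apply: (@l2_le _ _ _ _ 1 _ _ _ la).
    by apply: (measurable_quatZ (k := cst _)).
  move=> x; rewrite mul1r !normrZ ler_wpM2r// ger0_norm ?funrpos_ge0//.
  by rewrite /funrpos ge_max ler_norm normr_ge0.
have ln : (fun x => a^\- x *: - q) \in l2_fun mu.
  apply: (@l2_le _ _ _ _ 1 _ _ _ la).
    by apply: (measurable_quatZ (k := cst _)).
  move=> x; rewrite mul1r !normrZ normrN ler_wpM2r// ger0_norm ?funrneg_ge0//.
  by rewrite /funrneg ge_max -normrN ler_norm normr_ge0.
by apply: KD => //; apply: K_nonneg.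
Qed.

(** A property of square-integrable functions that holds for 1_D q and passes
    to sums and to limits in the seminorm holds for all of them. Real
    coefficients are reached through simple functions and positive and negative
    parts, and a quaternion has four of them. *)
Theorem l2_ind h : h \in l2_fun mu -> K h.
Proof.
move=> lh; have mh := l2_measurable lh.
have [m0 m1 m2 m3] := measurable_components mh.
have l (a : T -> R) q : measurable_fun setT a -> (forall x, `|a x| <= `|h x|) ->
    (fun x => a x *: q) \in l2_fun mu.
  move=> ma ah; apply: (@l2_le _ _ _ _ `|q| _ _ _ lh).
    by apply: (measurable_quatZ (k := cst _)).
  by move=> x; rewrite normrZ mulrC ler_wpM2l.
have l0 := l _ (Quat 1 0 0 0) m0 (fun x => let: And4 H _ _ _ := ler_norm_components (h x) in H).
have l1 := l _ (Quat 0 1 0 0) m1 (fun x => let: And4 _ H _ _ := ler_norm_components (h x) in H).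
have l2 := l _ (Quat 0 0 1 0) m2 (fun x => let: And4 _ _ H _ := ler_norm_components (h x) in H).
have l3 := l _ (Quat 0 0 0 1) m3 (fun x => let: And4 _ _ _ H := ler_norm_components (h x) in H).
have -> : h = (fun x => qre (h x) *: Quat 1 0 0 0) + (fun x => qi (h x) *: Quat 0 1 0 0)
   + (fun x => qj (h x) *: Quat 0 0 1 0) + (fun x => qk (h x) *: Quat 0 0 0 1).
  by apply/funext => x; apply: quatP => /=; ring.
have k0 := K_real m0 l0; have k1 := K_real m1 l1.
have k2 := K_real m2 l2; have k3 := K_real m3 l3.
have l01 := rpredD l0 l1; have l012 := rpredD l01 l2.
exact: (KD l012 l3 (KD l01 l2 (KD l0 l1 k0 k1) k2) k3).
Qed.

End L2induction.

(** * The real parts of the inner products of L2 and of H *)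

Section L2inner.
Context {R : realType} {d} {T : measurableType d}.
Variable mu : {measure set T -> \bar R}.
Implicit Types h k : T -> quat R.

Definition re_inner h k : R :=
  Rintegral mu setT (fun x => qre (quat_conj (k x) * h x)).

Lemma integrable_re_inner h k : h \in l2_fun mu -> k \in l2_fun mu ->
  mu.-integrable setT (EFin \o (fun x => qre (quat_conj (k x) * h x))).
Proof.
move=> lh lk.
have [mh hoo] := (l2P mu h).1 lh; have [mk koo] := (l2P mu k).1 lk.
have mhk : measurable_fun setT (fun x => qre (quat_conj (k x) * h x)).
  have [m0 _ _ _] := measurable_components
    (measurable_quatM (measurable_quat_conj mk) mh).
  exact: m0.
apply/integrableP; split; first exact/measurable_EFinP.
apply: (@le_lt_trans _ _ (\int[mu]_x ((`|h x| ^+ 2)%:E + (`|k x| ^+ 2)%:E))%E).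
  apply: ge0_le_integral => //.
  - by apply/measurable_EFinP; apply: measurableT_comp.
  - by apply: emeasurable_funD; exact: measurable_sqr_norm.
  move=> x _ /=; rewrite -EFinD lee_fin.
  have [+ _ _ _] := ler_norm_components (quat_conj (k x) * h x).
  move=> /le_trans; apply; rewrite quat_normM quat_norm_conj.
  have := sqr_ge0 (`|h x| - `|k x|); have := sqr_ge0 (`|h x| + `|k x|).
  by rewrite sqrrB sqrrD; lra.
rewrite ge0_integralD//; try exact: measurable_sqr_norm.
exact: lte_add_pinfty.
Qed.

Lemma re_inner_self h : h \in l2_fun mu -> re_inner h h = l2norm mu h ^+ 2.
Proof.
move=> lh; apply/EFin_inj; rewrite sqr_l2norm// /re_inner /Rintegral fineK.
  apply: eq_integral => x _; congr EFin; rewrite quat_sqnormM_conj /=; ring.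
exact/integrable_fin_num/integrable_re_inner.
Qed.

Lemma re_innerDl h h' k : h \in l2_fun mu -> h' \in l2_fun mu -> k \in l2_fun mu ->
  re_inner (h + h') k = re_inner h k + re_inner h' k.
Proof.
move=> lh lh' lk; rewrite /re_inner -RintegralD//; try exact: integrable_re_inner.
by apply: eq_Rintegral => x _; rewrite -[(h + h') x]/(h x + h' x) mulrDr.
Qed.

Lemma re_innerC h k : re_inner h k = re_inner k h.
Proof. by apply: eq_Rintegral => x _ /=; ring. Qed.

Lemma re_innerDr h k k' : h \in l2_fun mu -> k \in l2_fun mu -> k' \in l2_fun mu ->
  re_inner h (k + k') = re_inner h k + re_inner h k'.
Proof. by move=> lh lk lk'; rewrite re_innerC re_innerDl// !(re_innerC h). Qed.

Lemma sqr_l2normD h k : h \in l2_fun mu -> k \in l2_fun mu ->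
  l2norm mu (h + k) ^+ 2 = l2norm mu h ^+ 2 + 2 * re_inner h k + l2norm mu k ^+ 2.
Proof.
move=> lh lk; rewrite -!re_inner_self ?rpredD// re_innerDl ?rpredD//.
by rewrite !re_innerDr// (re_innerC k h); ring.
Qed.

(** With [re_dot_polarization], this turns an isometry of real linear spaces
    into a map preserving the real inner product. *)
Lemma re_inner_polarization h k : h \in l2_fun mu -> k \in l2_fun mu ->
  re_inner h k = (l2norm mu (h + k) ^+ 2 - l2norm mu (h - k) ^+ 2) / 4.
Proof.
move=> lh lk; have lB := rpredB lh lk.
have e1 := sqr_l2normD lh lk; have := sqr_l2normD lB lk.
have : re_inner h k = re_inner (h - k) k + re_inner k k.
  by rewrite -re_innerDl// subrK.
rewrite subrK (re_inner_self lk); lra.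
Qed.

End L2inner.

Lemma re_inner_indic {R : realType} {d} {T : measurableType d}
    (mu : {finite_measure set T -> \bar R}) D D' q q' :
  measurable D -> measurable D' ->
  re_inner mu (fun x => \1_D x *: q) (fun x => \1_D' x *: q') =
  fine (mu (D `&` D')) * qre (quat_conj q' * q).
Proof.
move=> mD mD'; have mI : measurable (D `&` D') by exact: measurableI.
transitivity (Rintegral mu setT (fun x => \1_(D `&` D') x * qre (quat_conj q' * q))).
  apply: eq_Rintegral => x _.
  by rewrite !indicE in_setI; case: (x \in D); case: (x \in D') => /=; ring.
rewrite RintegralZr//; last exact: integrable_indic.
by rewrite /Rintegral integral_indic// setIT.
Qed.

Section HilbertBasics.
Context {R : realType} {H : hilbertBimodType R}.
Implicit Types (x y z : H) (p q : quat R) (P : H -> H).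

Lemma ract0l q : ract (0 : H) q = 0.
Proof. by apply: (addrI (ract 0 q)); rewrite -ractDl !addr0. Qed.

Lemma ractNl x q : ract (- x) q = - ract x q.
Proof. by apply: (addrI (ract x q)); rewrite -ractDl !subrr ract0l. Qed.

Definition re_dot x y : R := qre (inner x y).

Lemma re_dotC x y : re_dot x y = re_dot y x.
Proof. by rewrite /re_dot (innerC x y). Qed.

Lemma re_dotDl x y z : re_dot (x + y) z = re_dot x z + re_dot y z.
Proof. by rewrite /re_dot innerDl. Qed.

Lemma re_dotDr x y z : re_dot x (y + z) = re_dot x y + re_dot x z.
Proof. by rewrite re_dotC re_dotDl !(re_dotC x). Qed.

Lemma re_dot0l x : re_dot 0 x = 0.
Proof. by apply: (addrI (re_dot 0 x)); rewrite -re_dotDl !addr0. Qed.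

Lemma re_dotNl x y : re_dot (- x) y = - re_dot x y.
Proof. by apply: (addrI (re_dot x y)); rewrite -re_dotDl !subrr re_dot0l. Qed.

Lemma re_dotNr x y : re_dot x (- y) = - re_dot x y.
Proof. by rewrite re_dotC re_dotNl re_dotC. Qed.

Lemma re_dot_self x : re_dot x x = `|x| ^+ 2.
Proof. by rewrite /re_dot inner_norm /=; ring. Qed.

Lemma re_dot_polarization x y :
  re_dot x y = (`|x + y| ^+ 2 - `|x - y| ^+ 2) / 4.
Proof.
rewrite -!re_dot_self !re_dotDl !re_dotDr !re_dotNl !re_dotNr (re_dotC y x).
by field.
Qed.

Lemma norm_ract x q : `|ract x q| = `|x| * `|q|.
Proof.
apply/eqP; rewrite -(@eqrXn2 _ 2) ?mulr_ge0//; apply/eqP.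
rewrite -re_dot_self /re_dot inner_ractl inner_ractr inner_norm exprMn.
by rewrite (sqr_quat_norm q) /quat_sqnorm /=; ring.
Qed.

Lemma re_dot_cvg (u : H^nat) x y : u @ \oo --> x ->
  (fun n => re_dot (u n) y) @ \oo --> re_dot x y.
Proof.
move=> ux; rewrite re_dot_polarization.
under eq_fun do rewrite re_dot_polarization.
apply: cvgM; last exact: cvg_cst.
have c z : (fun n => `|u n + z| ^+ 2) @ \oo --> `|x + z| ^+ 2.
  rewrite expr2; under eq_fun do rewrite expr2.
  have cz : (fun n => `|u n + z|) @ \oo --> `|x + z|.
    by apply: cvg_norm; apply: cvgD => //; exact: cvg_cst.
  exact: cvgM.
by apply: cvgB; exact: c.
Qed.

Section Projections.
Variable P : H -> H.
Hypothesis hP : orth_proj P.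

Lemma projD x y : P (x + y) = P x + P y.
Proof. by case: hP => -[_ + _] _ _ => /(_ x y Logic.I Logic.I) []. Qed.

Lemma proj_ract x q : P (ract x q) = ract (P x) q.
Proof. by case: hP => -[_ _ +] _ _ => /(_ x q Logic.I) []. Qed.

Lemma projK x : P (P x) = P x. Proof. by case: hP. Qed.

Lemma proj_sym x y : re_dot (P x) y = re_dot x (P y).
Proof. by case: hP => _ _ s; rewrite /re_dot s. Qed.

Lemma sqr_norm_proj x : re_dot (P x) x = `|P x| ^+ 2.
Proof. by rewrite -re_dot_self (proj_sym x (P x)) projK re_dotC. Qed.

Lemma norm_proj_le x : `|P x| <= `|x|.
Proof.
rewrite -(@ler_pXn2r _ 2) ?nnegrE//.
have -> : `|x| ^+ 2 = `|P x| ^+ 2 + `|x - P x| ^+ 2.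
  rewrite -!re_dot_self re_dotDl !re_dotDr !re_dotNl !re_dotNr (re_dotC x (P x)).
  by rewrite sqr_norm_proj -!re_dot_self; ring.
by rewrite lerDl sqr_ge0.
Qed.

End Projections.

Section SkewUnitary.
Variable J : H -> H.
Hypothesis skewJ : skew_selfadjoint (total_op J).
Hypothesis sqrJ : forall x, J (J x) = - x.

Lemma skewD x y : J (x + y) = J x + J y.
Proof. by case: skewJ => -[_ + _] _ _ => /(_ x y Logic.I Logic.I) []. Qed.

Lemma skew_ract x q : J (ract x q) = ract (J x) q.
Proof. by case: skewJ => -[_ _ +] _ _ => /(_ x q Logic.I) []. Qed.

(** The adjoint of J takes at y some z with <Jx, y> = <x, z> for all x, and
    skewness says that z = -Jy. *)
Lemma skew_dot x y : re_dot (J x) y = - re_dot x (J y).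
Proof.
case: skewJ => _ _ [edom eapp].
have dy : dom (adjoint (total_op J)) y by rewrite edom.
have /= := eapp _ dy; case: dy => z hz.
case: xgetP => [w _ /= hw wE|/(_ z) //].
by rewrite -re_dotNr -wE /re_dot (hw x Logic.I).
Qed.

Lemma skew_dot0 x : re_dot (J x) x = 0.
Proof. have := skew_dot x x; rewrite (re_dotC x); lra. Qed.

(** <Jx, Jx> = -<x, JJx> = <x, x>. *)
Lemma skew_norm x : `|J x| = `|x|.
Proof.
apply/eqP; rewrite -(@eqrXn2 _ 2)//; apply/eqP.
by rewrite -!re_dot_self skew_dot sqrJ re_dotNr opprK.
Qed.

End SkewUnitary.

End HilbertBasics.

(** * The coordinate on the ray and the scalar spectral measures *)

Section RayCoordinate.
Context {R : realType} {f : quat R}.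
Hypothesis fi : imaginary_unit f.
Implicit Types t : ray f.

Definition radius t : R := `|ray_val t|.

Lemma ray_valE t : ray_val t = radius t *: f.
Proof.
have [r /= r0 rq] := set_mem (valP t).
rewrite /radius (_ : ray_val t = r *: f); last by rewrite rq.
by rewrite normrZ (proj2 fi) mulr1 ger0_norm.
Qed.

Lemma radius_ge0 t : 0 <= radius t. Proof. exact: normr_ge0. Qed.

Lemma imaginary_unit_sqr (j : quat R) : imaginary_unit j -> j * j = - 1.
Proof.
move=> [j0 j1].
have jc : quat_conj j = - j by apply: quatP => //=; rewrite j0 oppr0.
by have := quat_sqnormM_conj j; rewrite jc mulNr j1 expr1n scale1r => <-; rewrite opprK.
Qed.

(** The symbol -qf of the spectral integral is the real number tau at the
    point q = tau f. *)
Lemma spectral_symbolE t : - (ray_val t * f) = (radius t)%:A.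
Proof. by rewrite ray_valE -scalerAl imaginary_unit_sqr// scalerN opprK. Qed.

Lemma measurable_ray_val : measurable_fun setT (@ray_val R f).
Proof.
apply: (@measurability _ _ _ _ _ _ (@open (quat R))) => //.
move=> _ [U oU <-]; rewrite setTI; apply: sub_sigma_algebra.
have /continuousP := @initial_continuous (ray f) (quat R) (@ray_val R f).
exact.
Qed.

Lemma measurable_radius : measurable_fun setT radius.
Proof. exact: measurable_quat_norm measurable_ray_val. Qed.

Lemma ray_itvE a b : ray_itv f a b = [set t | a <= radius t <= b].
Proof.
apply/seteqP; split=> [t [r ab]|t /= ab]; last by exists (radius t); rewrite ?ray_valE.
rewrite ray_valE => /eqP; rewrite -subr_eq0 -scalerBl scaler_eq0 subr_eq0.
move=> /orP[/eqP tr|/eqP f0]; first by rewrite /= tr.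
have := congr1 (fun q : quat R => `|q|) f0; rewrite (proj2 fi) normr0.
by move/eqP; rewrite oner_eq0.
Qed.

Lemma measurable_radius_itv (i : interval R) : measurable [set t | radius t \in i].
Proof.
rewrite -[X in measurable X]setTI.
exact: (measurable_radius measurableT (measurable_itv i)).
Qed.

Lemma ray_itv_measurable a b : measurable (ray_itv f a b).
Proof.
rewrite ray_itvE (_ : [set t | _] = [set t | radius t \in `[a, b]]).
  exact: measurable_radius_itv.
by apply/seteqP; split=> t /=; rewrite in_itv.
Qed.

End RayCoordinate.

(** The value 0 off the measurable sets makes the measure nonnegative on every
    set, where [spectral_mass] is unconstrained. The proof [hE] is an argument
    so that the measure structure below can be inferred. *)
Definition scalar_measure {R : realType} {f : quat R} {H : hilbertBimodType R}
    {E : set (ray f) -> H -> H} (hE : spectral_measure E) (x : H)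
    (D : set (ray f)) : \bar R :=
  if `[< measurable D >] then spectral_mass E x D else 0%E.

Section ScalarSpectralMeasure.
Context {R : realType} {f : quat R} {H : hilbertBimodType R}.
Context {E : set (ray f) -> H -> H}.
Hypothesis hE : spectral_measure E.
Implicit Types (x y : H) (D : set (ray f)).

(** Countable additivity applied to empty sets makes n E(0)x converge. *)
Lemma spectral0 x : E set0 x = 0.
Proof.
have : (fun n => \sum_(0 <= i < n) E set0 x) @ \oo --> E (\bigcup_(i : nat) set0) x.
  apply: (spectral_sigma hE (F := fun _ => set0)) => // i j _ _ [y []]//.
rewrite bigcup_const//.
have -> : (fun n => \sum_(0 <= i < n) E set0 x) = (fun n => E set0 x *+ n).
  by apply/funext => n; rewrite big_mkord sumr_const card_ord.
move=> c; have c1 : (fun n => E set0 x *+ n.+1) @ \oo --> E set0 x.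
  by move: c; rewrite -(cvg_shiftS (fun n => E set0 x *+ n)).
have c2 : (fun n => E set0 x *+ n.+1 - E set0 x *+ n) @ \oo --> (0 : H).
  by rewrite -(subrr (E set0 x)); apply: cvgB.
have c3 : (fun _ : nat => E set0 x) @ \oo --> (0 : H).
  by apply: cvg_trans c2; apply: near_eq_cvg; near=> n; rewrite /= mulrS addrK.
exact: (cvg_unique (@norm_hausdorff _ _) (cvg_cst _) c3).
Unshelve. all: by end_near. Qed.

Lemma spectral_massE x D : measurable D ->
  spectral_mass E x D = (`|E D x| ^+ 2)%:E.
Proof. by move=> mD; rewrite -(sqr_norm_proj (spectral_proj hE mD)). Qed.

Variable x : H.

Local Notation scalar_measure := (scalar_measure hE x).

Lemma scalar_measureE D : measurable D -> scalar_measure D = (`|E D x| ^+ 2)%:E.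
Proof. by move=> mD; rewrite /scalar_measure asboolT// spectral_massE. Qed.

Let scalar_measure0 : scalar_measure set0 = 0%E.
Proof. by rewrite scalar_measureE// spectral0 normr0 expr0n. Qed.

Let scalar_measure_ge0 D : (0 <= scalar_measure D)%E.
Proof.
rewrite /scalar_measure; case: asboolP => // mD.
by rewrite spectral_massE// lee_fin sqr_ge0.
Qed.

Let scalar_measure_sigma_additive : semi_sigma_additive scalar_measure.
Proof.
move=> F mF tF mUF; rewrite /scalar_measure asboolT//.
have -> : (fun n => \sum_(0 <= i < n)
    (if `[< measurable (F i) >] then spectral_mass E x (F i) else 0%E))%E =
    (fun n => (re_dot (\sum_(0 <= i < n) E (F i) x) x)%:E).
  apply/funext => n; elim: n => [|n IH]; first by rewrite !big_nil re_dot0l.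
  by rewrite !big_nat_recr//= IH asboolT// re_dotDl EFinD.
apply/fine_cvgP; split; first exact: nearW.
exact/re_dot_cvg/(spectral_sigma hE).
Qed.

HB.instance Definition _ := isMeasure.Build _ _ _ scalar_measure
  scalar_measure0 scalar_measure_ge0 scalar_measure_sigma_additive.

Let scalar_measure_fin : fin_num_fun scalar_measure.
Proof. by move=> D mD; rewrite scalar_measureE. Qed.

HB.instance Definition _ := Measure_isFinite.Build _ _ _ scalar_measure
  scalar_measure_fin.

End ScalarSpectralMeasure.

(** * The functional model of H generated by one vector *)

Section FunctionalModel.
Context {R : realType} {f : quat R} {H : hilbertBimodType R}.
Context {E : set (ray f) -> H -> H}.
Hypothesis hE : spectral_measure E.
Variable g : H.
Implicit Types (h k : ray f -> quat R) (x y : H) (D : set (ray f)).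

Local Notation sigma := (scalar_measure hE g : {finite_measure set (ray f) -> \bar R}).

(** The graph of 1_D q |-> E(D)g q on finite sums. It is defined as a relation
    because a step function has many presentations; that the image depends on
    the function alone follows from [re_dot_step]. *)
Inductive step_graph : (ray f -> quat R) -> H -> Prop :=
| StepNil : step_graph 0 0
| StepCons D q h x : measurable D -> step_graph h x ->
    step_graph ((fun t => \1_D t *: q) + h) (ract (E D g) q + x).

Lemma step_graph_indic D q : measurable D ->
  step_graph (fun t => \1_D t *: q) (ract (E D g) q).
Proof.
move=> mD; have := StepCons q mD StepNil; by rewrite !addr0.
Qed.

Lemma step_graphD h k x y : step_graph h x -> step_graph k y ->
  step_graph (h + k) (x + y).
Proof.
move=> hx ky; elim: hx => [|D q h' x' mD _ IH]; first by rewrite !add0r.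
by rewrite -!addrA; exact: StepCons.
Qed.

Lemma step_graph_rmul h x q : step_graph h x ->
  step_graph (fun t => h t * q) (ract x q).
Proof.
elim=> [|D p h' x' mD _ IH].
  rewrite ract0l (_ : (fun _ => _) = 0); first exact: StepNil.
  by apply/funext => t; rewrite mul0r.
rewrite ractDl -ractA; have := StepCons (p * q) mD IH.
congr step_graph; apply/funext => t.
by rewrite -[LHS]/(_ *: (p * q) + h' t * q) -[RHS]/((_ *: p + h' t) * q) mulrDl scalerAl.
Qed.

Lemma indic_l2 D q : measurable D -> (fun t => \1_D t *: q) \in l2_fun sigma.
Proof.
move=> mD; apply: (@l2_bounded _ _ _ _ `|q|).
  by apply: (measurable_quatZ (k := cst q)).
move=> t; rewrite normrZ ler_piMl// indicE ger0_norm ?ler0n//.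
by case: (_ \in _).
Qed.

Lemma step_graph_l2 h x : step_graph h x -> h \in l2_fun sigma.
Proof.
elim=> [|D q h' x' mD _ IH]; first exact: rpred0.
by rewrite rpredD// indic_l2.
Qed.

Lemma re_inner0 h : re_inner sigma h 0 = 0.
Proof.
rewrite /re_inner /Rintegral integral0_eq// => t _ /=.
by apply/eqP; rewrite eqe; apply/eqP; ring.
Qed.

(** On generators both sides equal sigma(D cap D') Re(conj(q') q), since
    <E(D)g, E(D')g> = <E(D cap D')g, g>. *)
Lemma re_dot_step h k x y : step_graph h x -> step_graph k y ->
  re_dot x y = re_inner sigma h k.
Proof.
move=> hx; elim=> [|D' q' k' y' mD' ky' IH].
  by rewrite re_dotC re_dot0l re_inner0.
have lh := step_graph_l2 hx; have lk' := step_graph_l2 ky'.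
have l' := indic_l2 q' mD'.
rewrite re_dotDr re_innerDr// -IH; congr (_ + _).
elim: hx {lh IH ky' lk'} => [|D q h' x' mD hx' IH].
  by rewrite re_dot0l re_innerC re_inner0.
have lh' := step_graph_l2 hx'; have l := indic_l2 q mD.
rewrite re_dotDl re_innerDl// -IH; congr (_ + _).
have mI : measurable (D `&` D') by exact: measurableI.
rewrite re_inner_indic//= scalar_measureE//=.
rewrite /re_dot inner_ractl inner_ractr.
have [_ _ sD'] := spectral_proj hE mD'; have [_ _ sI] := spectral_proj hE mI.
have -> : inner (E D g) (E D' g) = (`|E (D `&` D') g| ^+ 2)%:A.
  rewrite -sD' -(spectralI hE)// setIC -inner_norm.
  by rewrite sI (projK (spectral_proj hE mI)).
by rewrite /=; ring.
Qed.

(** The closure of [step_graph] in L^2(sigma) x H: [model h x] means x = U h for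
    the unitary map U that extends 1_D q |-> E(D)g q. *)
Definition model (h : ray f -> quat R) (x : H) : Prop :=
  h \in l2_fun sigma /\ forall e : R, 0 < e -> exists k y,
    [/\ step_graph k y, l2norm sigma (h - k) < e & `|x - y| < e].

Lemma model_l2 h x : model h x -> h \in l2_fun sigma. Proof. by case. Qed.

Lemma step_model h x : step_graph h x -> model h x.
Proof.
move=> hx; split; first exact: step_graph_l2 hx.
move=> e e0; exists h, x; split=> //; last by rewrite subrr normr0.
by rewrite subrr l2norm0.
Qed.

Lemma model_closed h x : h \in l2_fun sigma ->
  (forall e : R, 0 < e -> exists k y,
    [/\ model k y, l2norm sigma (h - k) < e & `|x - y| < e]) -> model h x.
Proof.
move=> lh hx; split=> // e e0; have e2 : 0 < e / 2 by rewrite divr_gt0.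
have [k [y [[lk ky] hk xy]]] := hx _ e2.
have [k' [y' [k'y' kk' yy']]] := ky _ e2.
have lk' := step_graph_l2 k'y'.
exists k', y'; split => //.
  rewrite -(subrK k h) -addrA (splitr e).
  apply: le_lt_trans (l2norm_triangle (rpredB lh lk) (rpredB lk lk')) _.
  exact: ltrD.
rewrite -(subrK y x) -addrA (splitr e).
by rewrite (le_lt_trans (ler_normD _ _))// ltrD.
Qed.

Lemma modelD h k x y : model h x -> model k y -> model (h + k) (x + y).
Proof.
move=> [lh hx] [lk ky]; split; first exact: rpredD.
move=> e e0; have e2 : 0 < e / 2 by rewrite divr_gt0.
have [h' [x' [hx' hh' xx']]] := hx _ e2; have [k' [y' [ky' kk' yy']]] := ky _ e2.
have lh' := step_graph_l2 hx'; have lk' := step_graph_l2 ky'.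
exists (h' + k'), (x' + y'); split; first exact: step_graphD.
  rewrite opprD addrACA (splitr e).
  apply: le_lt_trans (l2norm_triangle (rpredB lh lh') (rpredB lk lk')) _.
  exact: ltrD.
rewrite opprD addrACA (splitr e).
by rewrite (le_lt_trans (ler_normD _ _))// ltrD.
Qed.

Lemma model_rmul h x q : model h x -> model (fun t => h t * q) (ract x q).
Proof.
move=> [lh hx]; split; first exact: l2_rmul.
move=> e e0; have q0 : 0 < `|q| + 1 by rewrite ltr_wpDl.
have [h' [x' [hx' hh' xx']]] := hx (e / (`|q| + 1)) (divr_gt0 e0 q0).
have lh' := step_graph_l2 hx'.
exists (fun t => h' t * q), (ract x' q); split; first exact: step_graph_rmul.
  rewrite (_ : _ - _ = (fun t => (h - h') t * q)); last first.
    by apply/funext => t; rewrite -[RHS]/((h t - h' t) * q) mulrBl.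
  rewrite (le_lt_trans (l2norm_rmul _ _)) ?rpredB//.
  rewrite (@le_lt_trans _ _ ((`|q| + 1) * l2norm sigma (h - h')))//.
    by rewrite ler_wpM2r ?l2norm_ge0// lerDl.
  by rewrite mulrC -ltr_pdivlMr.
rewrite -ractNl -ractDl norm_ract (@le_lt_trans _ _ (`|x - x'| * (`|q| + 1)))//.
  by rewrite ler_wpM2l// lerDl.
by rewrite -ltr_pdivlMr.
Qed.

Lemma model0 : model 0 0. Proof. exact: step_model StepNil. Qed.

Lemma modelN h x : model h x -> model (- h) (- x).
Proof.
move=> /(model_rmul (-1)).
rewrite (_ : (fun t => _) = - h); last first.
  by apply/funext => t; rewrite mulrN1.
by rewrite -[X in ract _ X]scaleN1r ract_real scaleN1r.
Qed.

Lemma modelB h k x y : model h x -> model k y -> model (h - k) (x - y).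
Proof. by move=> hx ky; apply: modelD => //; exact: modelN. Qed.

Lemma model_sum (I : Type) (r : seq I) (F : I -> ray f -> quat R) (G : I -> H) :
  (forall i, model (F i) (G i)) -> model (\sum_(i <- r) F i) (\sum_(i <- r) G i).
Proof.
move=> FG; elim: r => [|i r IH]; first by rewrite !big_nil; exact: model0.
by rewrite !big_cons; exact: modelD.
Qed.

Lemma model_norm h x : model h x -> `|x| = l2norm sigma h.
Proof.
move=> [lh hx]; apply/eqP; rewrite -subr_eq0 -normr_le0; apply/ler_addgt0Pl => e e0.
rewrite addr0; have e2 : 0 < e / 2 by rewrite divr_gt0.
have [k [y [ky hk xy]]] := hx _ e2; have lk := step_graph_l2 ky.
have yk : `|y| = l2norm sigma k.
  apply/eqP; rewrite -(@eqrXn2 _ 2) ?l2norm_ge0//; apply/eqP.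
  by rewrite -re_dot_self -re_inner_self// (re_dot_step ky ky).
have h1 : l2norm sigma h <= l2norm sigma (h - k) + l2norm sigma k.
  by rewrite -{1}(subrK k h) l2norm_triangle ?rpredB.
have h2 : l2norm sigma k <= l2norm sigma h + l2norm sigma (h - k).
  by rewrite -{1}(subKr h k) l2norm_triangleB ?rpredB.
have x1 : `|x| <= `|x - y| + `|y| by rewrite -{1}(subrK y x) ler_normD.
have x2 : `|y| <= `|x| + `|x - y| by rewrite -{1}(subKr x y) ler_normB.
move: (l2norm _ _) (l2norm _ _) (l2norm _ _) yk h1 h2 hk => a b c yk h1 h2 hk.
by rewrite ler_norml; apply/andP; split; lra.
Qed.

Lemma model_dot h k x y : model h x -> model k y -> re_dot x y = re_inner sigma h k.
Proof.
move=> hx ky; rewrite re_dot_polarization re_inner_polarization ?(model_l2 hx) ?(model_l2 ky)//.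
by rewrite (model_norm (modelD hx ky)) (model_norm (modelB hx ky)).
Qed.

Lemma model_fun h x y : model h x -> model h y -> x = y.
Proof.
move=> hx hy; apply/eqP; rewrite -subr_eq0 -normr_eq0.
by rewrite (model_norm (modelB hx hy)) subrr -(model_norm model0) normr0.
Qed.

Lemma model_ae h k x : measurable_fun setT k -> {ae sigma, forall t, k t = h t} ->
  model h x -> model k x.
Proof.
move=> mk kh hx; have lh := model_l2 hx.
have lk := l2_ae mk lh kh.
apply: model_closed => // e e0; exists h, x; split=> //; last by rewrite subrr normr0.
rewrite (_ : l2norm _ _ = 0)//.
rewrite -(normr0 H) (model_norm model0); apply/l2norm_eq/ae_sqint.
- by apply: measurable_quatB => //; exact: l2_measurable lh.
- exact: measurable_cst.
- by apply: filterS kh => t kt; rewrite -[LHS]/(k t - h t) kt subrr.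
Qed.

(** By [l2_ind] it is enough to pass to limits: the images of a fast
    approximating sequence have summable steps because U is isometric, and H is
    complete. *)
Lemma model_total h : h \in l2_fun sigma -> exists x, model h x.
Proof.
move: h; apply: l2_ind.
- by move=> D q mD; exists (ract (E D g) q); exact/step_model/step_graph_indic.
- by move=> h k _ _ [x hx] [y ky]; exists (x + y); exact: modelD.
move=> h lh happ.
have p0 n : (0 : R) < 2^-1 ^+ n / 2 by exact: half_pow_gt0.
have ex n : exists ky : (ray f -> quat R) * H, model ky.1 ky.2 /\
    l2norm sigma (h - ky.1) < 2^-1 ^+ n / 2.
  by have [k [lk [y ky] hk]] := happ _ (p0 n); exists (k, y).
pose s n := projT1 (cid (ex n)).
have sm n : model (s n).1 (s n).2 by rewrite /s; case: cid => ky [].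
have sh n : l2norm sigma (h - (s n).1) < 2^-1 ^+ n / 2 by rewrite /s; case: cid => ky [].
have ls n := model_l2 (sm n).
have step n : `|(s n.+1).2 - (s n).2| <= 2^-1 ^+ n.
  rewrite (model_norm (modelB (sm n.+1) (sm n))).
  have -> : (s n.+1).1 - (s n).1 = (h - (s n).1) - (h - (s n.+1).1).
    by rewrite opprB [RHS]addrC subrKA.
  apply: le_trans (l2norm_triangleB (rpredB lh (ls n)) (rpredB lh (ls n.+1))) _.
  have := sh n; have := sh n.+1; rewrite exprS.
  by move: (p0 n); lra.
have [cs _] := cvg_summable_steps step sum_half_pow_le.
exists (limn (fun n => (s n).2)); apply: model_closed => // e e0.
have c0 := @cvg_half_pow R.
have /cvgrPdist_lt/(_ _ e0) [N1 _ HN1] := cs.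
have [N2 _ HN2] := cvgr_lt _ c0 _ e0.
pose N := maxn N1 N2.
exists (s N).1, (s N).2; split => //.
  rewrite (lt_trans (sh N))// (le_lt_trans _ (HN2 N _))//=; last exact: leq_maxr.
  by rewrite ler_pdivrMr// ler_peMr ?exprn_ge0//; lra.
by apply: HN1; exact: leq_maxl.
Qed.

(** The closed span of the E(D)g over bounded intervals D is H, so x is the limit
    of images of step functions; these functions have geometrically small
    steps because U is isometric, and L^2(sigma) is complete. *)
Lemma model_surj x : imaginary_unit f -> generating_vector E g -> exists h, model h x.
Proof.
move=> fi gen.
have p0 n : (0 : R) < 2^-1 ^+ n / 2 by exact: half_pow_gt0.
have ex n : exists ky : (ray f -> quat R) * H, step_graph ky.1 ky.2 /\
    `|x - ky.2| < 2^-1 ^+ n / 2.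
  have : closure (right_span [set E (ray_itv f ab.1 ab.2) g |
      ab in [set ab : R * R | 0 <= ab.1 < ab.2]]) x by rewrite gen.
  move=> /(_ _ (nbhsx_ballx x _ (p0 n))) [y [[s sS ->]]].
  rewrite -ball_normE /= => xy.
  suff [k ky] : exists k, step_graph k (\sum_(p <- s) ract p.1 p.2).
    by exists (k, \sum_(p <- s) ract p.1 p.2).
  elim: s sS {xy} => [|p s IH] sS; first by exists 0; rewrite big_nil; exact: StepNil.
  have [k ky] := IH (fun q qs => sS q (mem_behead (s := p :: s) qs)).
  have [ab _ pE] := sS p (mem_head _ _).
  rewrite big_cons -pE.
  by exists ((fun t => \1_(ray_itv f ab.1 ab.2) t *: p.2) + k); apply: StepCons => //;
    exact: (ray_itv_measurable fi).
pose s n := projT1 (cid (ex n)).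
have sm n : step_graph (s n).1 (s n).2 by rewrite /s; case: cid => ky [].
have sx n : `|x - (s n).2| < 2^-1 ^+ n / 2 by rewrite /s; case: cid => ky [].
have ls n := step_graph_l2 (sm n).
have step n : l2norm sigma ((s n.+1).1 - (s n).1) <= 2^-1 ^+ n.
  rewrite -(model_norm (modelB (step_model (sm n.+1)) (step_model (sm n)))).
  have -> : (s n.+1).2 - (s n).2 = (x - (s n).2) - (x - (s n.+1).2).
    by rewrite opprB [RHS]addrC subrKA.
  rewrite (le_trans (ler_normB _ _))//.
  have := sx n; have := sx n.+1; rewrite exprS.
  by move: (p0 n); lra.
have [h lh hs] := l2_complete ls step.
exists h; split => // e e0.
have c0 := @cvg_half_pow R.
have [N1 _ HN1] := cvgr_lt _ hs _ e0.
have [N2 _ HN2] := cvgr_lt _ c0 _ e0.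
pose N := maxn N1 N2.
exists (s N).1, (s N).2; split => //.
  by apply: HN1; exact: leq_maxl.
rewrite (lt_trans (sx N))// (le_lt_trans _ (HN2 N _))//=; last exact: leq_maxr.
by rewrite ler_pdivrMr// ler_peMr ?exprn_ge0//; lra.
Qed.

(** If a right linear contraction P sends U(1_D) to U(m 1_D) for every D, then it
    corresponds to left multiplication by m: this holds on step functions by
    right linearity, and both sides are continuous. *)
Lemma model_multiplier (m : ray f -> quat R) (P : H -> H) :
  measurable_fun setT m -> (forall t, `|m t| <= 1) ->
  (forall x y, P (x + y) = P x + P y) -> (forall x q, P (ract x q) = ract (P x) q) ->
  (forall x, `|P x| <= `|x|) ->
  (forall D, measurable D -> model (fun t => \1_D t *: m t) (P (E D g))) ->
  forall h x, model h x -> model (fun t => m t * h t) (P x).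
Proof.
move=> mm m1 PD Pq P1 PE h x [lh hx].
have lm k : k \in l2_fun sigma -> (fun t => m t * k t) \in l2_fun sigma.
  move=> lk; apply: (@l2_le _ _ _ _ 1 _ _ _ lk).
    by apply: measurable_quatM => //; exact: l2_measurable lk.
  by move=> t; rewrite mul1r quat_normM ler_piMl.
apply: model_closed; first exact: lm.
move=> e e0; have [k [y [ky hk xy]]] := hx _ e0; have lk := step_graph_l2 ky.
exists (fun t => m t * k t), (P y); split.
- elim: ky {hk xy lk} => [|D q k' y' mD ky' IH].
    rewrite (_ : P 0 = 0); last by apply: (addrI (P 0)); rewrite -PD !addr0.
    rewrite (_ : (fun _ => _) = 0); first exact: model0.
    by apply/funext => t; rewrite mulr0.
  rewrite PD Pq (_ : (fun t => _) =
     (fun t => (\1_D t *: m t) * q) + (fun t => m t * k' t)).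
    by apply: modelD => //; apply: model_rmul; exact: PE.
  apply/funext => t; rewrite -[RHS]/(_ + _) -[X in m t * X]/(_ *: q + k' t).
  by rewrite mulrDr -scalerAr scalerAl.
- apply: le_lt_trans hk; rewrite -[leRHS]mul1r; apply: l2norm_le => //.
  + by apply: measurable_quatB; [exact: l2_measurable (lm _ lh)|exact: l2_measurable (lm _ lk)].
  + exact: rpredB.
  move=> t; rewrite mul1r -[X in `|X| <= _]/(m t * h t - m t * k t) -mulrBr.
  by rewrite quat_normM ler_piMl.
have PN z : P (- z) = - P z.
  apply: (addrI (P z)); rewrite -PD !subrr.
  by apply: (addrI (P 0)); rewrite -PD !addr0.
by rewrite -PN -PD (le_lt_trans (P1 _)).
Qed.

Lemma model_spectral D h x : measurable D -> model h x ->
  model (fun t => \1_D t *: h t) (E D x).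
Proof.
move=> mD hx; have pD := spectral_proj hE mD.
rewrite (_ : (fun t => _) = (fun t => (\1_D t)%:A * h t)); last first.
  by apply/funext => t; rewrite -scalerAl mul1r.
apply: (model_multiplier (P := E D)) hx.
- by apply: (measurable_quatZ (k := cst 1)).
- by move=> t; rewrite quat_norm_real indicE ger0_norm ?ler0n//; case: (_ \in _).
- exact: projD.
- exact: proj_ract.
- exact: norm_proj_le.
move=> D' mD'; rewrite -(spectralI hE)//.
rewrite -[E _ _](ract1) setIC.
rewrite (_ : (fun t => _) = (fun t => \1_(D' `&` D) t *: 1)).
  by apply/step_model/step_graph_indic; exact: measurableI.
by apply/funext => t; rewrite scalerA !indicE in_setI; case: (_ \in _); case: (_ \in _);
  rewrite ?mulr1 ?mulr0.
Qed.

Lemma spectral_mass_model h x D : model h x -> measurable D ->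
  spectral_mass E x D = (\int[sigma]_(t in D) (`|h t| ^+ 2)%:E)%E.
Proof.
move=> hx mD; rewrite (spectral_massE hE)// (model_norm (model_spectral mD hx)).
rewrite sqr_l2norm ?(model_l2 (model_spectral mD hx))// /sqint.
rewrite [RHS]integral_mkcond; apply: eq_integral => t _; rewrite patchE indicE.
by case: (t \in D); rewrite ?scale1r// scale0r normr0 expr0n.
Qed.

Section Skew.
Variable J : H -> H.
Hypothesis skewJ : skew_selfadjoint (total_op J).
Hypothesis sqrJ : forall x, J (J x) = - x.
Hypothesis commJ : forall D, measurable D -> forall x, J (E D x) = E D (J x).

(** Test against indicators: the integral of |j|^2 over D is
    |E(D)Jg|^2 = |JE(D)g|^2 = |E(D)g|^2 = sigma(D), and the integral of Re j over
    D is Re <JE(D)g, E(D)g> = 0. *)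
Lemma model_skew_symbol j : model j (J g) ->
  {ae sigma, forall t, qre (j t) = 0 /\ `|j t| = 1}.
Proof.
move=> jg; have lj := model_l2 jg.
have mj := l2_measurable lj; have [mj0 _ _ _] := measurable_components mj.
have one D : measurable D -> model (fun t => \1_D t *: 1) (E D g).
  by move=> mD; rewrite -[E D g]ract1; exact/step_model/step_graph_indic.
have ae1 : {ae sigma, forall t, [set: ray f] t -> (`|j t| ^+ 2)%:E = 1%:E}.
  apply: integral_ae_eq => //.
  - apply/integrableP; split; first exact: measurable_sqr_norm.
    under eq_integral do rewrite gee0_abs ?lee_fin ?sqr_ge0//.
    by have [] := (l2P sigma j).1 lj.
  move=> D _ mD; rewrite -(spectral_mass_model jg mD) (spectral_massE hE)//.
  rewrite -commJ// (skew_norm skewJ sqrJ) integral_cst// mul1e.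
  by rewrite /= scalar_measureE.
have ae0 : {ae sigma, forall t, [set: ray f] t -> (qre (j t))%:E = 0%:E}.
  apply: integral_ae_eq => //.
  - have := integrable_re_inner lj (model_l2 (one _ measurableT)).
    apply: eq_integrable => // t _ /=; rewrite indicE in_setT /=; congr EFin; ring.
  move=> D _ mD; rewrite integral0.
  have := skew_dot0 skewJ (E D g).
  rewrite commJ// (model_dot (model_spectral mD jg) (one D mD)) /re_inner /Rintegral.
  move/(congr1 (@EFin R)); rewrite fineK; last first.
    apply/integrable_fin_num => //; apply: integrable_re_inner.
      exact: model_l2 (model_spectral mD jg).
    exact: model_l2 (one D mD).
  move=> z; rewrite -[RHS]z integral_mkcond; apply: eq_integral => t _.
  rewrite patchE /= indicE; case: (t \in D) => /=; first by congr EFin; ring.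
  by apply/eqP; rewrite eqe; apply/eqP; ring.
apply: filterS2 ae1 ae0 => t /(_ Logic.I)[j1] /(_ Logic.I)[j0]; split => //.
by apply/eqP; rewrite -(@eqrXn2 _ 2)// expr1n j1.
Qed.

End Skew.

End FunctionalModel.

(** * Measures with a density, and conjugation of imaginary units *)

Section Density.
Context {R : realType} {d} {T : measurableType d}.

Import HBNNSimple.

(** The integral is defined for every set function and looks at it on
    measurable sets only; this applies to [spectral_mass], which is no measure
    outside them. *)
Lemma eq_integral_setfun (m1 m2 : set T -> \bar R) (h : T -> \bar R) :
  (forall D, measurable D -> m1 D = m2 D) ->
  (\int[m1]_x h x = \int[m2]_x h x)%E.
Proof.
move=> m12; rewrite /integral; congr (ereal_sup _ - ereal_sup _)%E;
  apply: eq_imagel => s _; apply: eq_fsbigr => y _; rewrite m12//.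
Qed.

Lemma ge0_integral_density (mu nu : {measure set T -> \bar R}) (k phi : T -> R) :
  measurable_fun setT k -> (forall x, 0 <= k x) ->
  (forall D, measurable D -> nu D = \int[mu]_(x in D) (k x)%:E)%E ->
  measurable_fun setT phi -> (forall x, 0 <= phi x) ->
  (\int[nu]_x (phi x)%:E = \int[mu]_x (phi x * k x)%:E)%E.
Proof.
move=> mk k0 nuE mphi phi0.
have mEphi : measurable_fun setT (EFin \o phi) by exact/measurable_EFinP.
pose s := nnsfun_approx measurableT mEphi.
have s0 n x : 0 <= s n x by [].
have nds x : nondecreasing_seq (s ^~ x).
  by move=> m p mp; have /lefP := nd_nnsfun_approx measurableT mEphi mp; exact.
have cs x : (fun n => (s n x)%:E) @ \oo --> (phi x)%:E.
  exact: (@cvg_nnsfun_approx _ _ _ _ measurableT _ mEphi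
    (fun x _ => phi0 x : (0 <= (EFin \o phi) x)%E) x Logic.I).
have ms n : measurable_fun setT (s n) by [].
have es n : (\int[nu]_x (s n x)%:E = \int[mu]_x (s n x * k x)%:E)%E.
  rewrite integralT_nnsfun sintegralE.
  transitivity (\int[mu]_x \sum_(y \in range (s n))
      (y%:E * (\1_(s n @^-1` [set y]) x)%:E * (k x)%:E))%E.
    rewrite ge0_integral_fsum//; last 2 first.
    - move=> y; apply: emeasurable_funM; last exact/measurable_EFinP.
      by apply: measurable_funeM; exact/measurable_EFinP.
    - by move=> y x _; rewrite mule_ge0 ?lee_fin//; exact: nnfun_muleindic_ge0.
    apply: eq_fsbigr => y; rewrite inE => -[x0 _ <-].
    rewrite nuE// integral_mkcond -ge0_integralZl_EFin//; last 2 first.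
    - by move=> x _; rewrite patchE; case: ifP => // _; rewrite lee_fin.
    - by apply/measurable_restrict => //; rewrite setTI; apply: measurable_funTS; exact/measurable_EFinP.
    apply: eq_integral => x _; rewrite patchE indicE -muleA; congr (_ * _)%E.
    by case: (x \in _); rewrite ?mul1e// mul0e.
  apply: eq_integral => x _; rewrite EFinM [X in _ = (X%:E * _)%E](fimfunE (s n) x) -fsumEFin//.
  rewrite ge0_mule_fsuml//; last by move=> y; exact: nnfun_muleindic_ge0.
have c1 : (\int[nu]_x (s n x)%:E @[n --> \oo] --> \int[nu]_x (phi x)%:E)%E.
  have := @cvg_monotone_convergence _ T R nu setT measurableT (fun n x => (s n x)%:E).
  rewrite (_ : (fun x => limn _) = (fun x => (phi x)%:E)).
    apply => //.
    - by move=> n; exact/measurable_EFinP.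
    - by move=> n x _; rewrite lee_fin.
    - by move=> x _ m n mn; rewrite lee_fin; exact: nds.
  by apply/funext => x; apply/cvg_lim.
have c2 : (\int[mu]_x (s n x * k x)%:E @[n --> \oo] --> \int[mu]_x (phi x * k x)%:E)%E.
  have := @cvg_monotone_convergence _ T R mu setT measurableT (fun n x => (s n x * k x)%:E).
  rewrite (_ : (fun x => limn _) = (fun x => (phi x * k x)%:E)).
    apply => //.
    - by move=> n; apply/measurable_EFinP; exact: measurable_funM.
    - by move=> n x _; rewrite lee_fin mulr_ge0.
    - by move=> x _ m n mn; rewrite lee_fin ler_wpM2r//; exact: nds.
  apply/funext => x; apply/cvg_lim => //; under eq_fun do rewrite EFinM.
  by rewrite EFinM; apply: cvgeZr.
have c3 : (\int[nu]_x (s n x)%:E @[n --> \oo] --> \int[mu]_x (phi x * k x)%:E)%E.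
  by apply: cvg_trans c2; apply: near_eq_cvg; exact: nearW.
exact: (cvg_unique (@ereal_hausdorff R) c1 c3).
Qed.

End Density.

Section Alignment.
Context {R : realType}.
Implicit Types p q e f j : quat R.

Lemma anticommuting_unit f : imaginary_unit f ->
  exists2 e : quat R, `|e| = 1 & e * f = - (f * e).
Proof.
move=> [f0 f1]; have fs : quat_sqnorm f = 1 by rewrite -sqr_quat_norm f1 expr1n.
rewrite /quat_sqnorm f0 in fs.
pose n2 := qi f ^+ 2 + qj f ^+ 2.
have n20 : 0 <= n2 by rewrite addr_ge0// sqr_ge0.
have [n0|n0] := eqVneq n2 0.
  have i0 : qi f = 0.
    apply/eqP; rewrite -sqrf_eq0; apply/eqP; rewrite /n2 in n0.
    by have := sqr_ge0 (qi f); have := sqr_ge0 (qj f); lra.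
  exists (Quat 0 1 0 0).
    by rewrite quat_normE /quat_sqnorm /= expr1n !expr0n /= add0r !addr0 sqrtr1.
  by apply: quatP; rewrite /= ?f0 ?i0; ring.
have s0 : Num.sqrt n2 != 0 by rewrite sqrtr_eq0 -ltNge lt_def n0.
exists ((Num.sqrt n2)^-1 *: Quat 0 (qj f) (- qi f) 0).
  rewrite normrZ quat_normE /quat_sqnorm /= (_ : _ + _ = n2); last by rewrite /n2; ring.
  by rewrite normfV ger0_norm ?sqrtr_ge0// mulVf.
by apply: quatP; rewrite /= f0; ring.
Qed.

Context {d} {T : measurableType d}.

(** For imaginary units f and j the quaternion a = 1 - j f satisfies
    a f = f + j = j a, so u = a / |a| conjugates f to j unless a = 0. The
    exceptional case is j = -f, where any unit e anticommuting with f
    conjugates f to -f. *)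
Lemma measurable_alignment f (j : T -> quat R) : imaginary_unit f ->
  measurable_fun setT j -> exists u : T -> quat R,
  [/\ measurable_fun setT u, forall t, `|u t| = 1 &
      forall t, imaginary_unit (j t) -> u t * f = j t * u t].
Proof.
move=> fi mj; have [e e1 ef] := anticommuting_unit fi.
have ff := imaginary_unit_sqr fi.
pose a t := 1 - j t * f.
have ma : measurable_fun setT a.
  by apply: (measurable_quatB (h := cst 1)) => //; apply: (measurable_quatM (k := cst f)).
have mn := measurable_quat_norm ma.
pose S := [set t | `|a t| = 0].
have mS : measurable S.
  by rewrite -[S]setTI; exact: (mn measurableT [set 0] (measurable_set1 0)).
exists (fun t => \1_S t *: e + (`|a t|)^-1 *: a t); split.
- apply: measurable_quatD; first by apply: (measurable_quatZ (k := cst e)).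
  apply: measurable_quatZ => //.
  rewrite (_ : (fun t => _) = (fun y : R => y `^ (-1)) \o (fun t => `|a t|)).
    by apply: measurableT_comp => //; exact: measurable_powR.
  by apply/funext => t /=; rewrite powR_inv1.
- move=> t; have [tS|tS] := boolP (t \in S).
    by rewrite indicE tS (set_mem tS) invr0 scale0r addr0 scale1r.
  rewrite indicE (negbTE tS) scale0r add0r normrZ normfV normr_id mulVf//.
  by apply: contra tS => /eqP at0; apply/mem_set.
move=> t jt; have jj := imaginary_unit_sqr jt.
have aa : a t * f = j t * a t.
  by rewrite /a mulrBl mulrBr mulr1 mul1r -mulrA ff mulrA jj mulrN1 mulN1r !opprK addrC.
rewrite mulrDl mulrDr -!scalerAl -!scalerAr aa; congr (_ + _).
have [tS|tS] := boolP (t \in S); last by rewrite indicE (negbTE tS) !scale0r.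
congr (_ *: _).
have /eqP : a t = 0 by apply/normr0_eq0/(set_mem tS).
rewrite subr_eq0 => /eqP jf1.
have -> : j t = - f.
  by rewrite -[j t]mulr1 -[1]opprK -ff mulrN mulrA -jf1 mul1r.
by rewrite ef mulNr.
Qed.

End Alignment.

(** * The unitary map from the quotient space L2 onto H *)

Section L2classes.
Context {R : realType} {d} {T : measurableType d}.
Variable mu : {measure set T -> \bar R}.
Implicit Types (a b : L2 mu).

Lemma L2reprK a : L2class (L2repr a) = a.
Proof. exact: (@reprK _ (Quotient.quot (@l2_null _ _ _ mu))). Qed.

Lemma L2repr_l2 a : (L2repr a : T -> quat R) \in l2_fun mu.
Proof. exact: L2fun_valP. Qed.

Lemma L2class_eqP (h k : L2fun mu) :
  {ae mu, forall x, h x = k x} <-> L2class h = L2class k.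
Proof.
have E : {ae mu, forall x, h x = k x} <-> h - k \in @l2_null _ _ _ mu.
  rewrite inE /=; split; apply: filterS => x.
    by move=> hk; rewrite -[LHS]/(h x - k x) hk subrr.
  by rewrite -[LHS]/(h x - k x) => /eqP; rewrite subr_eq0 => /eqP.
rewrite E (Quotient.idealrBE (@l2_null _ _ _ mu)).
by split => [/eqP|hk]; [|apply/eqP].
Qed.

Lemma L2repr_class (h : L2fun mu) : {ae mu, forall x, L2repr (L2class h) x = h x}.
Proof. by apply/L2class_eqP; rewrite L2reprK. Qed.

Lemma L2repr_mk h (lh : h \in l2_fun mu) :
  {ae mu, forall x, L2repr (L2class (MkL2fun lh)) x = h x}.
Proof. exact: L2repr_class. Qed.

Lemma L2reprD a b : {ae mu, forall x, L2repr (a + b) x = L2repr a x + L2repr b x}.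
Proof.
have -> : a + b = L2class (L2repr a + L2repr b).
  rewrite -{1}(L2reprK a) -{1}(L2reprK b).
  exact/esym/(@Quotient.pi_add _ (@l2_null _ _ _ mu)).
exact: L2repr_class.
Qed.

Lemma L2repr_rmul a q : {ae mu, forall x, L2repr (L2rmul a q) x = L2repr a x * q}.
Proof. exact: L2repr_class. Qed.

Lemma L2repr_surj (h : T -> quat R) : h \in l2_fun mu ->
  exists a : L2 mu, {ae mu, forall x, L2repr a x = h x}.
Proof. by move=> lh; exists (L2class (MkL2fun lh)); exact: L2repr_mk. Qed.

Lemma Rintegral_opp (u v : T -> R) : (forall x, u x = - v x) ->
  mu.-integrable setT (EFin \o v) -> Rintegral mu setT u = - Rintegral mu setT v.
Proof.
move=> uv iv; rewrite -[RHS]mulN1r -RintegralZl//.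
by apply: eq_Rintegral => x _; rewrite uv mulN1r.
Qed.

Lemma quat_from_re (p : quat R) : p = Quat (qre p) (- qre (p * Quat 0 1 0 0))
  (- qre (p * Quat 0 0 1 0)) (- qre (p * Quat 0 0 0 1)).
Proof. by apply: quatP => /=; ring. Qed.

(** Through the right module structure the real part of the inner product
    determines all its components. *)
Lemma L2inner_components a b : L2inner a b = Quat (re_inner mu (L2repr a) (L2repr b))
  (- re_inner mu (fun x => L2repr a x * Quat 0 1 0 0) (L2repr b))
  (- re_inner mu (fun x => L2repr a x * Quat 0 0 1 0) (L2repr b))
  (- re_inner mu (fun x => L2repr a x * Quat 0 0 0 1) (L2repr b)).
Proof.
have i q := integrable_re_inner (l2_rmul q (L2repr_l2 a)) (L2repr_l2 b).
by apply: quatP; rewrite //=; apply: Rintegral_opp (i _) => x /=; ring.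
Qed.

End L2classes.

Section UnitaryModel.
Context {R : realType} {f : quat R} {H : hilbertBimodType R}.
Context {E : set (ray f) -> H -> H}.
Hypothesis hE : spectral_measure E.
Hypothesis fi : imaginary_unit f.
Variable g : H.
Hypothesis gen : generating_vector E g.
Local Notation sigma := (scalar_measure hE g : {finite_measure set (ray f) -> \bar R}).

Variable u : ray f -> quat R.
Hypothesis u_meas : measurable_fun setT u.
Hypothesis u1 : forall t, `|u t| = 1.

Lemma twist_l2 h : h \in l2_fun sigma -> (fun t => u t * h t) \in l2_fun sigma.
Proof.
move=> lh; apply: (@l2_le _ _ _ _ 1 _ _ _ lh).
  by apply: measurable_quatM => //; exact: l2_measurable lh.
by move=> t; rewrite quat_normM u1.
Qed.

Lemma twisted_model_total (a : L2 sigma) :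
  exists x, model hE g (fun t => u t * L2repr a t) x.
Proof. exact/model_total/twist_l2/L2repr_l2. Qed.

(** The map U(u h), on classes h: the factor u of norm one is left
    multiplication by a unitary. *)
Definition twisted_map (a : L2 sigma) : H := projT1 (cid (twisted_model_total a)).

Lemma twisted_mapP a : model hE g (fun t => u t * L2repr a t) (twisted_map a).
Proof. by rewrite /twisted_map; case: cid. Qed.

Lemma twisted_mapE a h x : h \in l2_fun sigma ->
  {ae sigma, forall t, L2repr a t = h t} ->
  model hE g (fun t => u t * h t) x -> twisted_map a = x.
Proof.
move=> lh ah hx; apply: (model_fun (twisted_mapP a)).
apply: model_ae hx; first exact/l2_measurable/twist_l2/L2repr_l2.
by apply: filterS ah => t ->.
Qed.

Lemma re_inner_twist h k :
  re_inner sigma (fun t => u t * h t) (fun t => u t * k t) = re_inner sigma h k.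
Proof.
apply: eq_Rintegral => t _; rewrite quat_conjM -mulrA (mulrA (quat_conj (u t))).
by rewrite quat_sqnormM_conj u1 expr1n scale1r mul1r.
Qed.

Lemma twisted_map_unitary : unitary_map twisted_map.
Proof.
split.
- move=> a b; apply: (twisted_mapE _ (L2reprD a b)).
    by apply: rpredD; exact: L2repr_l2.
  have := modelD (twisted_mapP a) (twisted_mapP b); congr model.
  by apply/funext => t; rewrite mulrDr.
- move=> a q; apply: (twisted_mapE _ (L2repr_rmul a q)).
    by apply: l2_rmul; exact: L2repr_l2.
  have := model_rmul q (twisted_mapP a); congr model.
  by apply/funext => t; rewrite mulrA.
- move=> a b; rewrite L2inner_components (quat_from_re (inner _ _)).
  have m q : qre (inner (twisted_map a) (twisted_map b) * q) =
      re_inner sigma (fun t => L2repr a t * q) (L2repr b).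
    rewrite -inner_ractl -[LHS]/(re_dot _ _).
    rewrite (model_dot (model_rmul q (twisted_mapP a)) (twisted_mapP b)).
    have -> : (fun t => u t * L2repr a t * q) = (fun t => u t * (L2repr a t * q)).
      by apply/funext => t; rewrite mulrA.
    exact: re_inner_twist.
  rewrite !m -[qre (inner _ _)]/(re_dot _ _) (model_dot (twisted_mapP a) (twisted_mapP b)).
  by rewrite re_inner_twist.
move=> x; have [h hx] := model_surj hE x fi gen; have lh := model_l2 hx.
have mc : measurable_fun setT (fun t => quat_conj (u t)) by exact: measurable_quat_conj.
have uu t : u t * quat_conj (u t) = 1.
  by have := quat_sqnormM_conj (quat_conj (u t)); rewrite quat_conjK quat_norm_conj u1 expr1n scale1r.
have lk : (fun t => quat_conj (u t) * h t) \in l2_fun sigma.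
  apply: (@l2_le _ _ _ _ 1 _ _ _ lh).
    by apply: measurable_quatM => //; exact: l2_measurable lh.
  by move=> t; rewrite quat_normM quat_norm_conj u1.
have [a ak] := L2repr_surj lk; exists a; apply: (twisted_mapE lk ak).
move: hx; congr model; apply/funext => t.
by rewrite mulrA uu mul1r.
Qed.

(** The measure <E(D)x, x> has density |h|^2 with respect to sigma when
    x = U h. *)
Lemma integral_spectral_mass h x (phi : ray f -> R) : model hE g h x ->
  measurable_fun setT phi -> (forall t, 0 <= phi t) ->
  (\int[spectral_mass E x]_t (phi t)%:E =
   \int[sigma]_t (phi t * `|h t| ^+ 2)%:E)%E.
Proof.
move=> hx mphi phi0.
rewrite (@eq_integral_setfun _ _ _ _ (scalar_measure hE x)); last first.
  by move=> D mD; rewrite /scalar_measure asboolT.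
apply: (@ge0_integral_density _ _ _ sigma (scalar_measure hE x)) => //.
- apply/measurable_EFinP; exact: measurable_sqr_norm (l2_measurable (model_l2 hx)).
- by move=> D mD; rewrite /= /scalar_measure asboolT// (spectral_mass_model hx).
Qed.

End UnitaryModel.

Arguments twisted_map {R f H E} hE g {u} u_meas u1.

(** * The operator A in the functional model *)

Section SpectralIntegral.
Context {R : realType} {f : quat R} {H : hilbertBimodType R}.
Context {E : set (ray f) -> H -> H}.
Hypothesis hE : spectral_measure E.
Hypothesis fi : imaginary_unit f.
Variable g : H.
Local Notation sigma := (scalar_measure hE g : {finite_measure set (ray f) -> \bar R}).

Variable J : H -> H.
Hypothesis skewJ : skew_selfadjoint (total_op J).
Hypothesis sqrJ : forall x, J (J x) = - x.
Hypothesis commJ : forall D, measurable D -> forall x, J (E D x) = E D (J x).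

Variable j : ray f -> quat R.
Hypothesis jg : model hE g j (J g).
Hypothesis ju : forall t, imaginary_unit (j t).

Lemma model_skew h x : model hE g h x -> model hE g (fun t => j t * h t) (J x).
Proof.
apply: model_multiplier.
- exact: l2_measurable (model_l2 jg).
- by move=> t; rewrite (proj2 (ju t)).
- exact: skewD.
- exact: skew_ract.
- by move=> x'; rewrite (skew_norm skewJ sqrJ).
- by move=> D mD; rewrite commJ//; exact: model_spectral.
Qed.

Lemma ray_point (r : R) : 0 <= r -> exists t : ray f, radius t = r.
Proof.
move=> r0; have rf : r *: f \in halfline f by rewrite inE; exists r.
exists (exist _ (r *: f) rf).
by rewrite /radius /ray_val /= normrZ (proj2 fi) mulr1 ger0_norm.
Qed.

(** Cut [0, N] into cells of width w. A Riemann sum of the spectral integral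
    corresponds to a step function times j h that differs from tau j h by at
    most w |h|; as w tends to 0 the Riemann sums approach v by hypothesis. *)
Lemma model_spectral_integral h x v (N : R) : 0 <= N -> model hE g h x ->
  is_spectral_integral E J (fun q => - (ray_val q * f)) (ray_itv f 0 N) x v ->
  model hE g (fun t => (\1_(ray_itv f 0 N) t * radius t) *: (j t * h t)) v.
Proof.
move=> N0 hx intv; have lh := model_l2 hx.
have mI := ray_itv_measurable fi 0 N.
have jhx := model_skew hx; have ljh := model_l2 jhx.
have mr := measurable_radius (f := f).
have mIr : measurable_fun setT (fun t : ray f => \1_(ray_itv f 0 N) t * radius t).
  exact: measurable_funM.
have I01 t : ray_itv f 0 N t -> radius t <= N.
  by rewrite ray_itvE// => /andP[].
apply: model_closed.
  apply: (@l2_le _ _ _ _ N _ _ _ ljh).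
    by apply: measurable_quatZ => //; exact: l2_measurable ljh.
  move=> t; rewrite normrZ ler_wpM2r// normrM (ger0_norm (radius_ge0 t)).
  have [tI|tI] := boolP (t \in ray_itv f 0 N); rewrite indicE.
    by rewrite tI normr1 mul1r I01//; exact/set_mem.
  by rewrite (negbTE tI) normr0 mul0r.
move=> e e0; have [delta d0 Hd] := intv _ e0.
have l0 : 0 < l2norm sigma h + 1 by rewrite ltr_wpDl ?l2norm_ge0.
(* Below delta, so that the Riemann sums are close to v, and below
   e / (|h| + 1), so that w |h| is less than e. *)
pose w := Num.min delta (e / (l2norm sigma h + 1)) / 2.
have m0 : 0 < Num.min delta (e / (l2norm sigma h + 1)).
  by rewrite lt_min d0 divr_gt0.
have w0 : 0 < w by rewrite divr_gt0.
have wm : w < Num.min delta (e / (l2norm sigma h + 1)).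
  by rewrite /w ltr_pdivrMr// ltr_pMr//; lra.
have [wd we] : w < delta /\ w < e / (l2norm sigma h + 1).
  by move: wm; rewrite lt_min => /andP[].
pose cell (t : ray f) := Num.truncn (radius t / w).
have rw0 (t : ray f) : 0 <= radius t / w by rewrite divr_ge0 ?radius_ge0 ?ltW.
have cellP t k : cell t = k -> k%:R * w <= radius t < k.+1%:R * w.
  move=> tk; have := truncn_itv (rw0 t); rewrite -/(cell t) tk.
  by rewrite ler_pdivlMr// ltr_pdivrMr.
(* The last cell is the one that contains N, so every cell meets the interval
   in its left end point, which is the tag. *)
pose M := (Num.truncn (N / w)).+1.
pose P (k : 'I_M) := ray_itv f 0 N `&` [set t | cell t = k].
have kN (k : 'I_M) : k%:R * w <= N.
  rewrite -ler_pdivlMr//.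
  have /andP[+ _] := truncn_itv (divr_ge0 N0 (ltW w0)); apply: le_trans.
  by rewrite ler_nat -ltnS ltn_ord.
have tag (k : 'I_M) : {t : ray f | radius t = k%:R * w}.
  by apply: cid; apply: ray_point; rewrite mulr_ge0// ltW.
pose q k := projT1 (tag k).
have qE k : radius (q k) = k%:R * w by exact: projT2 (tag k).
have mP k : measurable (P k).
  apply: measurableI => //.
  rewrite (_ : [set t | _] = [set t | radius t \in `[k%:R * w, k.+1%:R * w[]).
    exact: measurable_radius_itv.
  apply/seteqP; split=> t /=; rewrite in_itv /=; first exact: cellP.
  rewrite -ler_pdivlMr// -ltr_pdivrMr// => tk.
  by apply/eqP; rewrite /cell truncn_eq.
have tP : trivIset setT P.
  by move=> k l _ _ [t [[_ /= tk] [_ /= tl]]]; apply: val_inj; rewrite /= -tk -tl.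
have cellM t : ray_itv f 0 N t -> (cell t < M)%N.
  move=> tI; rewrite /M ltnS; apply: le_truncn.
  by rewrite ler_wpM2r ?I01// invr_ge0 ltW.
have UP : \bigcup_k P k = ray_itv f 0 N.
  apply/seteqP; split=> [t [k _ []]//|t tI].
  by exists (Ordinal (cellM _ tI)).
have Pq k : P k (q k).
  split; first by rewrite ray_itvE//= qE kN mulr_ge0// ltW.
  have : cell (q k) == k by rewrite /cell truncn_eq// qE mulfK ?gt_eqF// lexx ltr_nat ltnSn.
  by move/eqP.
have near_tag k t : P k t -> `|radius t - radius (q k)| <= w.
  move=> [_ /= /cellP]; rewrite qE -natr1 => /andP[h1 h2].
  by rewrite ler_norml; apply/andP; split; lra.
have osc k t : P k t -> `|- (ray_val t * f) - - (ray_val (q k) * f)| < delta.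
  move=> Pt; rewrite !spectral_symbolE// -scalerBl quat_norm_real.
  exact: le_lt_trans (near_tag _ _ Pt) wd.
have := Hd M P q mP tP UP Pq osc; set S := \sum_(k < M) _ => vS.
pose G := \sum_(k < M) (fun t => (j t * (\1_(P k) t *: h t)) * - (ray_val (q k) * f)).
have GS : model hE g G S.
  by apply: model_sum => k; apply/model_rmul/model_skew/model_spectral.
exists G, S; split => //.
have lG := model_l2 GS.
apply: (@le_lt_trans _ _ (w * l2norm sigma h)); last first.
  apply: (@le_lt_trans _ _ (w * (l2norm sigma h + 1))).
    by rewrite (ler_wpM2l (ltW w0))// lerDl.
  by rewrite -ltr_pdivlMr.
apply: l2norm_le => //; first exact: ltW.
  apply: measurable_quatB; last exact: l2_measurable lG.
  by apply: measurable_quatZ => //; exact: l2_measurable ljh.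
move=> t; rewrite -[X in `|X|]/(_ - G t) /G fct_sumE.
have -> : \sum_(k < M) (j t * (\1_(P k) t *: h t)) * - (ray_val (q k) * f) =
    (\sum_(k < M) \1_(P k) t * radius (q k)) *: (j t * h t).
  rewrite scaler_suml; apply: eq_bigr => k _.
  by rewrite spectral_symbolE// -!scalerAr mulr1 scalerA mulrC.
rewrite -scalerBl normrZ quat_normM (proj2 (ju t)) mul1r ler_wpM2r//.
have [tI|tI] := boolP (t \in ray_itv f 0 N); rewrite indicE; last first.
  rewrite (negbTE tI) mul0r big1 ?subrr ?normr0 ?ltW// => k _.
  by rewrite indicE memNset ?mul0r// => -[] /mem_set; rewrite (negbTE tI).
rewrite tI mul1r; have {}tI := set_mem tI; pose k0 := Ordinal (cellM _ tI).
rewrite (bigD1 k0)//= big1 ?addr0.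
  have Pt : P k0 t by split.
  by rewrite indicE mem_set// mul1r; exact: near_tag.
move=> k kk0; rewrite indicE memNset ?mul0r// => -[_ /= tk].
by move: kk0; apply/negP; rewrite negbK; apply/eqP/val_inj.
Qed.

(** The truncations of tau j h to [0, n] converge to it in L^2 by dominated
    convergence, while their images converge to y. *)
Lemma model_symbol_cvg h x y (v : H^nat) : model hE g h x ->
  (fun t => radius t *: (j t * h t)) \in l2_fun sigma ->
  (forall n, is_spectral_integral E J (fun q => - (ray_val q * f))
    (ray_itv f 0 n%:R) x (v n)) -> v @ \oo --> y ->
  model hE g (fun t => radius t *: (j t * h t)) y.
Proof.
move=> hx lF intv vy; apply: model_closed => // e e0.
set F := fun t => radius t *: (j t * h t) in lF *.
pose G n t : quat R := (\1_(ray_itv f 0 n%:R) t * radius t) *: (j t * h t).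
have Gv n : model hE g (G n) (v n).
  exact: model_spectral_integral (ler0n _ n) hx (intv n).
have FG n t : (F - G n) t = (1 - \1_(ray_itv f 0 n%:R) t) *: F t.
  by rewrite -[LHS]/(F t - G n t) /G -scalerA scalerBl scale1r.
have c0 : (fun n => l2norm sigma (F - G n)) @ \oo --> (0 : R).
  apply: (l2norm_dominated_cvg0 lF).
  - move=> n; apply: measurable_quatB; first exact: l2_measurable lF.
    exact: l2_measurable (model_l2 (Gv n)).
  - move=> n t; rewrite FG normrZ ler_piMl// indicE.
    by case: (_ \in _); rewrite ?subrr ?normr0// subr0 normr1.
  move=> t; apply: (@cvg_trans _ ((fun _ => 0) @ \oo)); last exact: cvg_cst.
  apply: near_eq_cvg; near=> n; rewrite FG indicE mem_set ?subrr ?scale0r ?normr0//.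
  rewrite ray_itvE//= radius_ge0 /=.
  near: n; exists (Num.truncn (radius t)).+1 => // n /= tn.
  by rewrite (le_trans (ltW (truncnS_gt _)))// ler_nat.
have [N1 _ HN1] := cvgr_lt _ c0 _ e0.
have /cvgrPdist_lt/(_ _ e0) [N2 _ HN2] := vy.
pose N := maxn N1 N2; exists (G N), (v N); split => //.
  by apply: HN1; exact: leq_maxl.
by apply: HN2; exact: leq_maxr.
Unshelve. all: by end_near. Qed.

End SpectralIntegral.

Section SkewSymbol.
Context {R : realType} {f : quat R} {H : hilbertBimodType R}.
Context {E : set (ray f) -> H -> H}.
Hypothesis hE : spectral_measure E.
Hypothesis fi : imaginary_unit f.
Variables (g : H) (J : H -> H).
Hypothesis gen : generating_vector E g.
Hypothesis skewJ : skew_selfadjoint (total_op J).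
Hypothesis sqrJ : forall x, J (J x) = - x.
Hypothesis commJ : forall D, measurable D -> forall x, J (E D x) = E D (J x).

(** On the null set where U^-1(Jg) is not an imaginary unit its value is
    replaced by f. *)
Lemma exists_skew_symbol : exists j : ray f -> quat R,
  [/\ measurable_fun setT j, model hE g j (J g) & forall t, imaginary_unit (j t)].
Proof.
have [j0 j0g] := model_surj hE (J g) fi gen.
have mj0 := l2_measurable (model_l2 j0g).
have [mr _ _ _] := measurable_components mj0.
have mn := measurable_quat_norm mj0.
pose S := [set t | qre (j0 t) = 0] `&` [set t | `|j0 t| = 1].
have mS : measurable S.
  apply: measurableI.
    by rewrite -[X in measurable X]setTI; exact: (mr measurableT [set 0] (measurable_set1 0)).
  by rewrite -[X in measurable X]setTI; exact: (mn measurableT [set 1] (measurable_set1 1)).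
pose j t := \1_S t *: j0 t + \1_(~` S) t *: f.
have mj : measurable_fun setT j.
  apply: measurable_quatD; first exact: measurable_quat_indic.
  by apply: measurable_quat_indic => //; exact: measurableC.
exists j; split => //.
  apply: (model_ae mj _ j0g).
  apply: filterS (model_skew_symbol skewJ sqrJ commJ j0g) => t [t0 t1].
  by rewrite /j !indicE in_setC mem_set//= scale1r scale0r addr0.
move=> t; rewrite /j !indicE in_setC; have [tS|tS] := boolP (t \in S) => /=.
  by rewrite scale1r scale0r addr0; have [] := set_mem tS.
by rewrite scale1r scale0r add0r.
Qed.

End SkewSymbol.

Theorem theorem3 (R : realType) (f : quat R) (H : hilbertBimodType R)
    (A : partial_op H) (E : set (ray f) -> H -> H) (J : H -> H) :
  imaginary_unit f ->
  skew_selfadjoint A ->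
  spectral_pair A E J ->
  simple_spectrum E ->
  exists sigma : {finite_measure set (ray f) -> \bar R},
    unitarily_equivalent A (mul_op sigma).
Proof.
move=> fi _ [hE _ skewJ commJ sqrJ domA appA] [g gen].
pose sigma : {finite_measure set (ray f) -> \bar R} := scalar_measure hE g.
have [j [mj jg ju]] := exists_skew_symbol hE fi gen skewJ sqrJ commJ.
have [u [u_meas u1 uf]] := measurable_alignment fi mj.
pose Phi : L2 sigma -> H := twisted_map hE g u_meas u1.
exists sigma, Phi.
have integralE (a : L2 sigma) : (\int[spectral_mass E (Phi a)]_q
    (`|ray_val q| ^+ 2)%:E =
    \int[sigma]_x (`|ray_val x| ^+ 2 * `|L2repr a x| ^+ 2)%:E)%E.
  rewrite (integral_spectral_mass (twisted_mapP u_meas u1 a)).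
  - by apply: eq_integral => t _; rewrite quat_normM u1 mul1r.
  - by apply: measurable_funX; exact: measurable_radius.
  - by move=> t; exact: sqr_ge0.
have uPhi : unitary_map Phi := twisted_map_unitary hE fi gen u_meas u1.
split => //.
  rewrite domA; apply/seteqP; split=> [x /= xA|_ [a /= aQ <-]].
    have [a ax] := unitary_surj uPhi x.
    by exists a => //=; rewrite -integralE ax.
  by rewrite /= integralE.
move=> a aQ; have dA : dom A (Phi a) by rewrite domA /= integralE.
have [v intv vA] := appA _ dA.
pose k t := ray_val t * L2repr a t.
have la := L2repr_l2 a.
have lk : k \in l2_fun sigma.
  apply/l2P; split.
    apply: measurable_quatM; last exact: l2_measurable la.
    exact: measurable_ray_val.
  rewrite /sqint (eq_integral (fun x => (`|ray_val x| ^+ 2 * `|L2repr a x| ^+ 2)%:E))//.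
  by move=> t _; rewrite quat_normM exprMn.
(* The multiplier tau f of Q moves past u as tau j. *)
have kE : (fun t => u t * k t) = (fun t => radius t *: (j t * (u t * L2repr a t))).
  apply/funext => t; rewrite /k (ray_valE fi) -scalerAl -scalerAr; congr (_ *: _).
  by rewrite !mulrA uf.
apply/esym; apply: (twisted_mapE u_meas u1 lk).
  apply: filterS (L2repr_class (insubd 0 k)) => t ->.
  by rewrite -[L2fun_val _]/(val _) insubdK.
rewrite kE; apply: (model_symbol_cvg fi skewJ sqrJ commJ jg ju _ _ intv vA).
  exact: twisted_mapP.
by rewrite -kE; exact: twist_l2.
Qed.
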